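(* For any character polynomial $P$ and any prime power $q$, $$\lim_{n\to\infty}q^{-(n^2-n)}\sum_{T\in\mathcal{T}_n(\mathbb{F}_q)}P(T)=\sum_{i=0}^{\infty}\frac{\langle P,R_i\rangle}{q^i}.$$ In particular, both the limit on the left and the series on the right converge.
   Context: $\mathcal{T}_n(\mathbb{F}_q)$ denotes the set of maximal tori $T$ of the algebraic group $\mathrm{GL}_n$ that are defined over $\mathbb{F}_q$ (a torus over $\mathbb{F}_q$ is an algebraic subgroup defined over $\mathbb{F}_q$ which becomes diagonalizable over $\overline{\mathbb{F}}_q$). Each such $T$ determines the set of its $n$ eigenlines $\{L_1,\ldots,L_n\}$ in $\overline{\mathbb{F}}_q^{\,n}$, which are linearly independent; the Frobenius $x\mapsto x^q$ permutes this set, giving a permutation $\sigma_T\in S_n$, well defined up to conjugacy. A character polynomial is $P\in\mathbb{Q}[X_1,X_2,\ldots]$; it gives for every $n$ a class function on $S_n$ by $\sigma\mapsto P(c_1(\sigma),c_2(\sigma),\ldots)$, where $c_j(\sigma)$ is the number of $j$-cycles of $\sigma$. Set $P(T)=P(c_1(\sigma_T),c_2(\sigma_T),\ldots)$. The co-invariant algebra is $R[x_1,\ldots,x_n]=\mathbb{Q}[x_1,\ldots,x_n]/I_n$, where $I_n$ is the ideal generated by all symmetric polynomials with zero constant term; it is graded, $R[x_1,\ldots,x_n]=\bigoplus_i R_i[x_1,\ldots,x_n]$ (by polynomial degree), and $S_n$ acts on each $R_i[x_1,\ldots,x_n]$ by permuting the variables. $\langle P,R_i[x_1,\ldots,x_n]\rangle$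 is the inner product over $S_n$ of the class function given by $P$ with the character of $R_i[x_1,\ldots,x_n]$. For fixed $P$ and $i$ it is eventually independent of $n$, and $\langle P,R_i\rangle:=\lim_{n\to\infty}\langle P,R_i[x_1,\ldots,x_n]\rangle$. *)

(* Defs.v *)
(* `normed_module` is loaded without `Import`: one of the notations of the
   normed-module files clashes with `mpoly`. *)
From HB Require Import structures.
From mathcomp Require Import all_boot all_order all_algebra all_fingroup.
From mathcomp Require Import boolp classical_sets cardinality fsbigop.
From mathcomp Require Import reals topology sequences.
From mathcomp Require normed_module.
From mathcomp Require Import mpoly.

Set Implicit Arguments.
Unset Strict Implicit.
Unset Printing Implicit Defensive.

Import GRing.Theory Num.Theory.
Import normed_module.numFieldNormedType.Exports.

Local Open Scope classical_set_scope.
Local Open Scope quotient_scope.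
Local Open Scope ring_scope.

Section CharacterPolynomials.

Definition num_cycles (n : nat) (j : nat) (s : 'S_n) : nat :=
  #|[set c in porbits s | #|c| == j]|.

(* The variable of index [j : 'I_k] stands for X_{j+1}, the number of
   (j+1)-cycles. An element of Q[X_1, X_2, ...] involves finitely many
   variables, hence is some [P : {mpoly rat[k]}]. *)
Definition charpol_eval (k : nat) (P : {mpoly rat[k]}) (n : nat) (s : 'S_n)
    : rat :=
  P.@[fun j : 'I_k => (num_cycles j.+1 s)%:R].

End CharacterPolynomials.

Section Tori.

(* [K], with the embedding [iota], plays the role of an algebraic closure of
   the finite field [F]. Algebraic subgroups of GL_n are given by their sets of
   [K]-points, and polynomial functions on matrices by polynomials in the n * n
   entries, listed by [mxvec]. *)
Variables (F : finFieldType) (K : closedFieldType) (iota : {rmorphism F -> K}).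
Variable n : nat.
Implicit Types (T : set 'M[K]_n) (p : {mpoly K[n * n]}).

Definition mx_eval p (A : 'M[K]_n) : K := p.@[fun i => mxvec A 0 i].

Definition vanishes_on T p : Prop := forall A, T A -> mx_eval p A = 0.

Definition algebraic_subgroup T : Prop :=
  [/\ exists S : set {mpoly K[n * n]},
        T = [set A | A \in unitmx /\ forall p, S p -> mx_eval p A = 0],
      T 1%:M,
      forall A B, T A -> T B -> T (A *m B)
    & forall A, T A -> T (invmx A)].

(* The vanishing ideal of [T] is generated by polynomials over [F]. *)
Definition defined_over T : Prop :=
  forall p, vanishes_on T p ->
    exists (m : nat) (c : 'I_m -> {mpoly K[n * n]})
           (g : 'I_m -> {mpoly F[n * n]}),
      (forall j, vanishes_on T (map_mpoly iota (g j))) /\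
      p = \sum_j c j * map_mpoly iota (g j).

Definition torus T : Prop :=
  algebraic_subgroup T /\
  exists2 Q : 'M[K]_n, Q \in unitmx & forall A, T A -> diagonalizable_for Q A.

Definition maximal_torus T : Prop :=
  torus T /\ forall T', torus T' -> T `<=` T' -> T' = T.

(* This set is finite, so that [\sum_(T \in max_tori) _], whose value is 0 by
   convention for infinite supports, is the expected sum. *)
Definition max_tori : set (set 'M[K]_n) :=
  [set T | maximal_torus T /\ defined_over T].

Definition eigenlines T : set (set 'cV[K]_n) :=
  [set L | exists v : 'cV[K]_n,
     [/\ v != 0, L = range (fun c : K => c *: v)
       & forall A, T A -> exists a : K, A *m v = a *: v]].

Definition frob (v : 'cV[K]_n) : 'cV[K]_n := map_mx (fun x => x ^+ #|F|) v.

(* [s] is the action of Frobenius on the eigenlines of [T], for some numbering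
   L_0, ..., L_{n-1} of these lines. *)
Definition frob_perm T (s : 'S_n) : Prop :=
  exists L : 'I_n -> set 'cV[K]_n,
    [/\ injective L, range L = eigenlines T
      & forall i, frob @` L i = L (s i)].

(* The numbering, hence [sigma T], is chosen arbitrarily; the conjugacy class
   of [sigma T] does not depend on this choice. *)
Definition sigma T : 'S_n := xget 1%g [set s | frob_perm T s].

End Tori.

Section Trace.

Variables (K : fieldType) (V : lmodType K).

Definition is_basis (W : set V) (d : nat) (b : 'I_d -> V) : Prop :=
  (forall j, W (b j)) /\
  (forall w, W w -> exists! c : 'rV[K]_d, w = \sum_j c 0 j *: b j).

(* Trace of [f] on a finite-dimensional [f]-stable subspace [W]. *)
Definition trace_on (W : set V) (f : V -> V) : K :=
  xget 0 [set t | exists (d : nat) (b : 'I_d -> V) (A : 'M[K]_d),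
    [/\ is_basis W b, forall j, f (b j) = \sum_i A i j *: b i & t = \tr A]].

End Trace.

Section Coinvariants.

Variable n : nat.

Definition coinv_ideal_spec (p : {mpoly rat[n]}) : Prop :=
  exists (m : nat) (a g : 'I_m -> {mpoly rat[n]}),
    (forall j, g j \is symmetric /\ (g j)@_0%MM = 0) /\
    p = \sum_j a j * g j.

Definition coinv_ideal : {pred {mpoly rat[n]}} :=
  fun p => `[< coinv_ideal_spec p >].

Lemma coinv_idealP p : reflect (coinv_ideal_spec p) (p \in coinv_ideal).
Proof. exact: asboolP. Qed.

Lemma coinv_ideal_closed : idealr_closed coinv_ideal.
Proof.
split.
- apply/coinv_idealP; exists 0%N, (fun=> 0), (fun=> 0).
  by split; [case | rewrite big_ord0].
- apply/coinv_idealP => -[m [a [g [gP e]]]].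
  have := congr1 (mcoeff 0%MM) e; rewrite mcoeff1 eqxx raddf_sum /=.
  rewrite big1 => [/eqP|j _]; first by rewrite oner_eq0.
  by rewrite rmorphM /= (gP j).2 mulr0.
- move=> c p r /coinv_idealP[m1 [a1 [g1 [g1P ->]]]].
  move=> /coinv_idealP[m2 [a2 [g2 [g2P ->]]]].
  apply/coinv_idealP; exists (m1 + m2)%N.
  exists (fun i => match split i with inl j => c * a1 j | inr j => a2 j end).
  exists (fun i => match split i with inl j => g1 j | inr j => g2 j end).
  split=> [i|]; first by case: (split i).
  rewrite big_split_ord /= mulr_sumr; congr (_ + _); apply: eq_bigr => j _.
    by case: split_ordP => [i /lshift_inj <-|i /eqP];
      rewrite ?mulrA // eq_lrshift.
  by case: split_ordP => [i /eqP|i /rshift_inj <-]; rewrite ?eq_rlshift.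
Qed.

HB.instance Definition _ :=
  isIdealr.Build {mpoly rat[n]} coinv_ideal coinv_ideal_closed.

Definition coinv := {ideal_quot coinv_ideal}.

HB.instance Definition _ := GRing.ComNzRing.on coinv.
HB.instance Definition _ := EqQuotient.on coinv.

Definition coinv_scale (c : rat) (x : coinv) : coinv := \pi_coinv c%:MP * x.

Lemma coinv_scaleA a b x :
  coinv_scale a (coinv_scale b x) = coinv_scale (a * b) x.
Proof. by rewrite /coinv_scale mulrA mpolyCM [in RHS]rmorphM. Qed.

Lemma coinv_scale1 : left_id 1 coinv_scale.
Proof. by move=> x; rewrite /coinv_scale mpolyC1 rmorph1 mul1r. Qed.

Lemma coinv_scaleDr : right_distributive coinv_scale +%R.
Proof. by move=> c x y; rewrite /coinv_scale mulrDr. Qed.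

Lemma coinv_scaleDl x : {morph coinv_scale^~ x : a b / a + b}.
Proof. by move=> a b; rewrite /coinv_scale mpolyCD raddfD mulrDl. Qed.

HB.instance Definition _ := GRing.Zmodule_isLmodule.Build rat coinv
  coinv_scaleA coinv_scale1 coinv_scaleDr coinv_scaleDl.

(* Independent of the representative, see [coinv_act_pi]. *)
Definition coinv_act (s : 'S_n) (x : coinv) : coinv :=
  \pi_coinv (msym s (generic_quotient.repr x)).

Lemma coinv_act_pi s p : coinv_act s (\pi_coinv p) = \pi_coinv (msym s p).
Proof.
apply/eqP; rewrite -Quotient.idealrBE -raddfB /=.
have : generic_quotient.repr (\pi_coinv p) - p \in coinv_ideal.
  by rewrite Quotient.idealrBE generic_quotient.reprK.
move=> /coinv_idealP[m [a [g [gP ->]]]].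
apply/coinv_idealP; exists m, (fun j => msym s (a j)), g; split=> //.
rewrite raddf_sum /=; apply: eq_bigr => j _.
by rewrite rmorphM /= (issymP _ (gP j).1).
Qed.

Definition coinv_deg (i : nat) : set coinv :=
  [set \pi_coinv p | p in [set p : {mpoly rat[n]} | p \is i.-homog]].

Definition coinv_char (i : nat) (s : 'S_n) : rat :=
  trace_on (coinv_deg i) (coinv_act s).

End Coinvariants.

Definition coinv_inner (k : nat) (P : {mpoly rat[k]}) (n i : nat) : rat :=
  (n`!)%:R^-1 * \sum_(s : 'S_n) charpol_eval P s * coinv_char i s.

(* The sequence is eventually constant, so [limn] is its actual limit. *)
Definition stable_inner (R : realType) (k : nat) (P : {mpoly rat[k]}) (i : nat)
    : R :=
  limn (fun n => ratr (coinv_inner P n i) : R).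

(* Main.v *)
(* Maximal tori of GL_n are the full diagonal tori of frames of lines, and the
   tori over F_q are those whose frame is Frobenius-stable.  For w in S_n, the
   invertible matrices A with Frob(A) = A w form a torsor under GL_n(F_q), and
   each stable frame with Frobenius type w carries prod_c (q^|c| - 1) such
   scalings, c running over the cycles of w.  Hence
     sum_T P(T) = |GL_n(F_q)| / n! * sum_w P(w) / prod_c (q^|c| - 1).
   On the other side Q[x_1..x_n] is free over the symmetric polynomials on the
   Artin monomials, so the graded character of the coinvariant algebra at w is
   prod_(i <= n) (1 - t^i) / prod_c (1 - t^|c|).  Both together give, for every
   n, q^-(n^2 - n) sum_T P(T) = H_n(P)(1/q), where H_n(P) is the polynomial
   sum_i <P, R_i[x_1..x_n]> t^i.
   To let n grow, mark a j-cycle: this gives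
     (1 - t^j) H_n(X_j P) =
       1/j prod_(n - j < i <= n) (1 - t^i) H_(n - j)(P(X_j + 1)),
   and H_n(1) = 1.  By induction on P, the coefficients of H_n(P) stabilise and
   H_n(P)(1/q) tends to the sum of the stable power series at 1/q. *)
Require Import Defs.
From HB Require Import structures.
From mathcomp Require Import all_boot all_order all_algebra all_fingroup.
From mathcomp Require Import boolp classical_sets cardinality fsbigop.
From mathcomp Require Import reals topology sequences.
From mathcomp Require normed_module.
From mathcomp Require Import mpoly.
From mathcomp Require Import cyclic pgroup abelian separable finfield.
From mathcomp Require Import zify ring lra.

Set Implicit Arguments.
Unset Strict Implicit.
Unset Printing Implicit Defensive.

Import GRing.Theory Num.Theory.
Import normed_module.numFieldNormedType.Exports.

(** * Equivariant maps and cycles *)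

(** The field [K] is infinite, so nothing can be counted in it directly: frames and scalings are
    counted inside the finite set of fixed points of a suitable power of Frobenius. That the torsor
    is nonempty is an instance of Lang's theorem; it is obtained from a count as well. There are q^n
    vectors u with Frob(u_j) = u_(w j), and their coordinates on any K-independent subfamily
    spanning them lie in F_q, so such a subfamily must have n members. A torus over F_q is given
    through generators of its vanishing ideal, whereas the count needs a Frobenius-stable frame;
    Galois descent for polynomials links the two. Power series are avoided: Molien's formula is an
    identity between polynomials, checked modulo every power of the variable. Coefficientwise
    stabilisation of H_n(P) does not by itself allow limit and sum to be exchanged. Instead of a
    uniform bound, the recursion carries both limits along: the factor 1 - q^-j is nonzero, so it
    determines the new value and the new sum from the old ones, in the same way. *)

Section EquivariantFunctions.
Local Open Scope ring_scope.

Variables (T J : finType) (w : {perm T}) (phi : J -> J).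

(** The pick depends only on the set [porbit w x], so all points of a cycle get the same
    representative. The default is never reached, a cycle being nonempty. *)
Definition orbit_rep (x : T) : T := odflt x [pick y in porbit w x].

Lemma orbit_repP x : orbit_rep x \in porbit w x.
Proof.
rewrite /orbit_rep; case: pickP => [y //|/(_ x)]; first by rewrite porbit_id.
Qed.

Lemma porbit_rep x : porbit w (orbit_rep x) = porbit w x.
Proof. by apply/eqP; rewrite eq_porbit_mem orbit_repP. Qed.

Lemma eq_orbit_rep x y : porbit w x = porbit w y -> orbit_rep x = orbit_rep y.
Proof.
rewrite /orbit_rep => ->; case: pickP => // /(_ y); by rewrite porbit_id.
Qed.

Lemma orbit_rep_id x : orbit_rep (orbit_rep x) == orbit_rep x.
Proof. by apply/eqP/eq_orbit_rep/porbit_rep. Qed.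

Lemma orbit_rep_exp x : {k | (w ^+ k)%g (orbit_rep x) = x}.
Proof.
have : exists k, (w ^+ k)%g (orbit_rep x) == x.
  have /porbitP[k e] : x \in porbit w (orbit_rep x).
    by rewrite porbit_rep porbit_id.
  by exists k; rewrite -e.
by move=> /sigW[k /eqP]; exists k.
Qed.

Lemma iter_phi_mod x (j : J) k : iter #|porbit w x| phi j = j ->
  iter k phi j = iter (k %% #|porbit w x|) phi j.
Proof.
move=> h; rewrite [in LHS](divn_eq k #|porbit w x|) addnC iterD.
congr iter; elim: (k %/ _)%N => //= m IH.
by rewrite mulSn addnC iterD h.
Qed.

Lemma expg_porbit_mod x k : (w ^+ k)%g x = (w ^+ (k %% #|porbit w x|))%g x.
Proof.
rewrite [in LHS](divn_eq k #|porbit w x|) addnC expgD permM.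
have e y : porbit w y = porbit w x ->
  (w ^+ (k %/ #|porbit w x| * #|porbit w x|))%g y = y.
  move=> h; rewrite mulnC expgM permX; elim: (k %/ _)%N => //= m ->.
  by rewrite permX -h iter_porbit.
rewrite -permM -expgD addnC expgD permM e //.
Qed.

(** Over one period the trajectory of [x] has no repetition, so [k] and [l] agree modulo the cycle
    length, and the iterates of [phi] at [j] depend only on that residue. *)
Lemma iter_phi_eq x (j : J) k l : iter #|porbit w x| phi j = j ->
  (w ^+ k)%g x = (w ^+ l)%g x -> iter k phi j = iter l phi j.
Proof.
move=> h; rewrite expg_porbit_mod [RHS]expg_porbit_mod.
rewrite [in X in _ -> X](iter_phi_mod k h) [in X in _ ->
  X](iter_phi_mod l h) => e.
have ltm a : (a %% #|porbit w x| < #|porbit w x|)%N.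
  by rewrite ltn_mod lt0n card_porbit_neq0.
have E a : (w ^+ (a %% #|porbit w x|))%g x =
  nth x (traject w x #|porbit w x|) (a %% #|porbit w x|).
  by rewrite nth_traject // permX.
move: e; rewrite !E => /eqP; rewrite nth_uniq ?size_traject
  ?uniq_traject_porbit //.
by move=> /eqP->.
Qed.

Definition is_rep : pred T := fun x => orbit_rep x == x.
Definition reps := {x in is_rep}.
Definition to_rep (x : T) : reps := exist _ (orbit_rep x) (orbit_rep_id x).

Lemma to_repE (x : reps) : to_rep (val x) = x.
Proof. by apply/val_inj/eqP; exact: (valP x). Qed.

Lemma big_porbits (R : comNzRingType) (g : {set T} -> R) :
  \prod_(c in porbits w) g c = \prod_(x : reps) g (porbit w (val x)).
Proof.
have -> : porbits w = [set porbit w x | x in [set x | orbit_rep x == x]].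
  apply/setP => c; apply/imsetP/imsetP => [[x _ ->]|[x _ ->]]; last by exists x.
  by exists (orbit_rep x); rewrite ?inE ?orbit_rep_id ?porbit_rep.
rewrite big_imset /=; last first.
  by move=> x y; rewrite !inE => /eqP hx /eqP hy /eq_orbit_rep; rewrite hx hy.
transitivity (\prod_(x in is_rep) g (porbit w x)); last exact: big_sub.
by apply: eq_bigl => x; rewrite inE.
Qed.

Lemma big_iter_porbit (R : comNzRingType) (th : J -> R) (r : T -> J) x :
  (forall i, r (w i) = phi (r i)) ->
  \prod_(i in porbit w x) th (r i) =
  \prod_(k < #|porbit w x|) th (iter k phi (r x)).
Proof.
move=> rw; rewrite (eq_bigl _ _ (porbit_traject w x)).
rewrite -big_uniq ?uniq_traject_porbit //=.
rewrite (big_nth x) size_traject big_mkord; apply: eq_bigr => k _.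
rewrite nth_traject //; congr th; elim: (k : nat) => //= m <-; exact: rw.
Qed.

(* A map [r] with [r \o w = phi \o r] amounts to the choice, for each cycle [c]
   of [w], of a fixed point of [phi ^ #|c|], namely the value of [r] at a
   representative of [c]. *)
Lemma sum_equivariant (R : comNzRingType) (th : J -> R) :
  \sum_(r : {ffun T -> J} | [forall i, r (w i) == phi (r i)]) \prod_i th (r i) =
  \prod_(c in porbits w)
    \sum_(j | iter #|c| phi j == j) \prod_(k < #|c|) th (iter k phi j).
Proof.
rewrite big_porbits bigA_distr_big_dep.
have pS i : porbit w (w i) = porbit w i by have := porbit_perm w 1 i;
  rewrite expg1.
(* [ex] spreads a value given at the representative along its cycle; [re] restricts to
   representatives. The exponent is determined only modulo the cycle length, which is why [h] must
   take values fixed by that iterate of [phi]. *)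
pose ex (h : {ffun reps -> J}) :=
  [ffun i => iter (sval (orbit_rep_exp i)) phi (h (to_rep i))].
pose re (r : {ffun T -> J}) := [ffun x : reps => r (val x)].
have rX (r : {ffun T -> J}) k i : [forall i, r (w i) == phi (r i)] ->
  r ((w ^+ k)%g i) = iter k phi (r i).
  by move=> /forallP rw; rewrite permX; elim: k => //= k <-; exact/eqP.
have exK (r : {ffun T -> J}) : [forall i, r (w i) == phi (r i)] ->
  ex (re r) = r.
  move=> rw; apply/ffunP => i; rewrite !ffunE -rX //=.
  by case: orbit_rep_exp => k /= ->.
rewrite (reindex_onto ex re) /=; last by move=> r; exact: exK.
apply: eq_big => [h|h /andP[hw /eqP hK]]; last first.
  transitivity (\prod_(x : reps) \prod_(i in porbit w (val x)) th (ex h i)).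
    rewrite -(big_porbits (fun c => \prod_(i in c) th (ex h i))).
    rewrite (partition_big (porbit w) (mem (porbits w))) /=;
      last by move=> i _; apply: imset_f.
    apply: eq_bigr => c /imsetP[x _ ->]; apply: eq_bigl => i.
    by rewrite eq_porbit_mem.
  apply: eq_bigr => x _; rewrite big_iter_porbit; last by move=> i; apply/eqP;
    move: i; apply/forallP.
  by rewrite -[in RHS]hK; apply: eq_bigr => k _; rewrite [in RHS]ffunE.
apply/andP/familyP => [[hw /eqP hK] x|hF].
  have e : h x = ex h (val x) by rewrite -{1}hK ffunE.
  by rewrite e unfold_in -rX // permX iter_porbit.
  have hF' x : iter #|porbit w (val x)| phi (h x) = h x by apply/eqP/hF.
  split; last first.
    apply/eqP/ffunP => x; rewrite !ffunE; case: orbit_rep_exp => k /= e.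
    rewrite to_repE; apply: (@iter_phi_eq _ _ k 0 (hF' x)).
    by rewrite expg0 perm1 -[RHS]e [in RHS](eqP (valP x)).
  apply/forallP => i; rewrite !ffunE; apply/eqP.
  have -> : to_rep (w i) = to_rep i.
    exact/val_inj/eq_orbit_rep.
  case: orbit_rep_exp => k /= ek; case: orbit_rep_exp => l /= el.
  rewrite -iterS; apply: (iter_phi_eq (hF' _)) => /=.
  rewrite expgSr permM el -[RHS]ek; congr ((w ^+ k)%g _).
  exact: eq_orbit_rep.
Qed.
End EquivariantFunctions.

(** * Marking a cycle *)

Section CycleCounts.
Local Open Scope ring_scope.

(** Any bound [B] above [n] is allowed, so that products attached to permutations of different sizes
    can be compared factor by factor. *)
Lemma prod_porbits (R : comNzRingType) n B (s : 'S_n) (g : nat ->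
  R) : (n <= B)%N ->
  \prod_(c in porbits s) g #|c| = \prod_(j < B.+1) g j ^+ num_cycles j s.
Proof.
move=> nB; have lt_c (c : {set 'I_n}) : (#|c| < B.+1)%N.
  by rewrite ltnS (leq_trans _ nB) // -[n in (_ <= n)%N]card_ord max_card.
rewrite (partition_big (fun c : {set 'I_n} => Ordinal (lt_c c)) predT) //=.
apply: eq_bigr => j _; rewrite -prodr_const;
  apply: eq_big => [c|c /andP[_ /eqP <-]] //.
by rewrite inE -val_eqE.
Qed.

(** Points are easier to count than cycles: identities between numbers of [j]-cycles are reduced to
    this count, and a positive [j] is then cancelled. *)
Lemma num_cycles_mul n j (s : 'S_n) :
  (num_cycles j s * j = #|[set x | #|porbit s x| == j]|)%N.
Proof.
rewrite /num_cycles -sum_nat_const.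
rewrite (eq_bigr (fun c : {set 'I_n} => #|c|)); last by move=> c;
  rewrite inE => /andP[_ /eqP].
rewrite (eq_bigr (fun c : {set 'I_n} => \sum_(x in c) 1)%N); last by move=> c;
  rewrite sum1_card.
rewrite -sum1_card [RHS](partition_big (porbit s) [pred c | c \in [set c in
  porbits s | #|c| == j]]) /=; last first.
  by move=> x; rewrite !inE => ->; rewrite imset_f.
apply: eq_bigr => c; rewrite inE => /andP[/imsetP[x _ ->] cj].
apply: eq_bigl => y; rewrite inE eq_porbit_mem andb_idl //.
by rewrite -eq_porbit_mem => /eqP ->.
Qed.

Lemma num_cycles0 n (s : 'S_n) : num_cycles 0 s = 0%N.
Proof.
apply: eq_card0 => c; rewrite inE; apply/negP => /andP[/imsetP[x _ ->]].
by apply/negP/card_porbit_neq0.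
Qed.

Lemma porbitJ (T : finType) (s t : {perm T}) x :
  porbit (s ^ t)%g (t x) = t @: porbit s x.
Proof.
have E k : ((s ^ t) ^+ k)%g (t x) = t ((s ^+ k)%g x).
  by rewrite -conjXg conjgE !permM permK.
apply/setP => y; apply/porbitP/imsetP => [[k ->]|[z /porbitP[k ->] ->]].
  by exists ((s ^+ k)%g x); rewrite ?mem_porbit ?E.
by exists k; rewrite E.
Qed.

Lemma num_cyclesJ n j (s t : 'S_n) : num_cycles j (s ^ t)%g = num_cycles j s.
Proof.
case: j => [|j]; first by rewrite !num_cycles0.
apply/eqP; rewrite -(eqn_pmul2r (ltn0Sn j)) !num_cycles_mul; apply/eqP.
rewrite -[RHS](card_imset _ (@perm_inj _ t)); apply: eq_card => x; rewrite inE.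
apply/idP/imsetP => [h|[y]]; last by rewrite inE => h ->;
  rewrite porbitJ card_imset //; exact: perm_inj.
exists (t^-1%g x); last by rewrite permKV.
by rewrite inE -(card_imset _ (@perm_inj _ t)) -porbitJ permKV.
Qed.

Lemma perm_map_exists (T : finType) (s t : seq T) :
  uniq s -> uniq t -> size s = size t -> exists p : {perm T}, map p s = t.
Proof.
elim: s t => [|x s IH] [|y t] //=; first by exists 1%g.
move=> /andP[xs us] /andP[yt ut] [e]; have [p ep] := IH _ us ut e.
exists (p * tperm (p x) y)%g; rewrite permM tpermL; congr (_ :: _).
rewrite -ep; apply/eq_in_map => z zs /=; rewrite permM tpermD //.
  by apply: contraNneq xs => /perm_inj ->.
by apply: contraNneq yt => ->; rewrite -ep map_f.
Qed.

Lemma perm_extend_exists (I T : finType) (g f : I -> T) : injective g ->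
  injective f ->
  exists p : {perm T}, forall i, p (g i) = f i.
Proof.
move=> gi fi; have [|||p ep] := @perm_map_exists T (codom g) (codom f).
- by rewrite /codom /image_mem map_inj_uniq ?enum_uniq.
- by rewrite /codom /image_mem map_inj_uniq ?enum_uniq.
- by rewrite !size_codom.
exists p => i; move: ep; rewrite !codomE. rewrite -map_comp => /eq_in_map;
  apply.
by rewrite mem_enum.
Qed.

(** * Appending a cycle to a permutation *)

Section AddCycle.
Variables m j : nat.

(** The solutions form a coset of the group of permutations supported on the first [m] points. *)
Lemma card_perm_extend (f : 'I_j -> 'I_(m + j)) : injective f ->
  #|[set p : 'S_(m + j) | [forall b, p (rshift m b) == f b]]| = m`!.
Proof.
move=> /(perm_extend_exists (@rshift_inj m j))[p0 ep0].
pose A := [set lshift j a | a : 'I_m].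
rewrite -[m in RHS](card_ord m) -(card_imset _ (@lshift_inj m j)) -card_perm.
rewrite -[RHS](card_imset _ (@mulIg _ p0)) /=; apply: eq_card => p.
rewrite inE; apply/forallP/imsetP => [h|[p1 h ->] b].
  exists (p * p0^-1)%g; last by rewrite mulgKV.
  rewrite unfold_in; apply/fintype.subsetP => x; rewrite inE /= permM => h1.
  rewrite -(splitK x); case: (split x) (splitK x) h1 => [a _ _|b <-] /=;
    first by apply: imset_f.
  by rewrite (eqP (h b)) -ep0 permK eqxx.
rewrite permM -ep0; apply/eqP; congr (p0 _); apply: (out_perm h).
by apply/imsetP => -[a _ /eqP]; rewrite eq_sym eq_lrshift.
Qed.

Definition add_cycle_fun (s : 'S_m) (x : 'I_(m + j)) : 'I_(m + j) :=
  match split x with inl a => lshift j (s a) | inr b => rshift m (ordS b) end.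

Lemma add_cycle_inj s : injective (add_cycle_fun s).
Proof.
move=> x y; rewrite /add_cycle_fun -{2}(splitK x) -{2}(splitK y).
case: (split x) => a; case: (split y) => b /= /eqP;
  rewrite ?eq_lrshift ?eq_rlshift //.
  by rewrite eq_lshift => /eqP/perm_inj->.
by rewrite eq_rshift => /eqP/(can_inj (@ordSK j))->.
Qed.

Definition add_cycle (s : 'S_m) : 'S_(m + j) := perm (@add_cycle_inj s).

Lemma add_cycle_lshift s a : add_cycle s (lshift j a) = lshift j (s a).
Proof. by rewrite permE /add_cycle_fun (unsplitK (inl a)). Qed.

Lemma add_cycle_rshift s b : add_cycle s (rshift m b) = rshift m (ordS b).
Proof. by rewrite permE /add_cycle_fun (unsplitK (inr b)). Qed.

Lemma add_cycle_injective : injective add_cycle.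
Proof.
move=> s t e; apply/permP => a; apply: (@lshift_inj m j).
by rewrite -!add_cycle_lshift e.
Qed.

(** Each of the last [j] points is already the image of its cyclic predecessor, so by injectivity
    the first [m] points are not sent there. *)
Lemma add_cycle_surj (w : 'S_(m + j)) :
  (forall b, w (rshift m b) = rshift m (ordS b)) -> exists s, w = add_cycle s.
Proof.
move=> hw; have hl a : exists a', w (lshift j a) == lshift j a'.
  rewrite -(splitK (w (lshift j a)));
    case: (split _) (splitK (w (lshift j a))) => [a' _|b /= e];
    first by exists a'.
  have := hw (ord_pred b); rewrite ord_predK e => /perm_inj/eqP.
  by rewrite eq_rlshift.
pose f a := xchoose (hl a); have fE a : w (lshift j a) =
  lshift j (f a) by exact/eqP/(xchooseP (hl a)).
have fI : injective f.
  by move=> a b e; apply: (@lshift_inj m j); apply: (@perm_inj _ w);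
    rewrite !fE e.
exists (perm fI); apply/permP => x; rewrite -(splitK x);
  case: (split x) => [a|b] /=.
  by rewrite add_cycle_lshift fE permE.
by rewrite add_cycle_rshift hw.
Qed.

Lemma porbit_add_cycle_l s a : porbit (add_cycle s) (lshift j a) =
  lshift j @: porbit s a.
Proof.
have E k : (add_cycle s ^+ k)%g (lshift j a) = lshift j ((s ^+ k)%g a).
  by rewrite !permX; elim: k => //= k ->; rewrite add_cycle_lshift.
apply/setP => y; apply/porbitP/imsetP => [[k ->]|[z /porbitP[k ->] ->]].
  by exists ((s ^+ k)%g a); rewrite ?mem_porbit ?E.
by exists k; rewrite E.
Qed.

Lemma iter_ordS (b : 'I_j) k : iter k (@ordS j) b = ((b + k) %% j)%N :> nat.
Proof.
elim: k => [|k IH] /=; first by rewrite addn0 modn_small.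
by rewrite IH -addn1 modnDml addn1 addnS.
Qed.

Lemma porbit_add_cycle_r s b : porbit (add_cycle s) (rshift m b) =
  @rshift m j @: 'I_j.
Proof.
have E k : (add_cycle s ^+ k)%g (rshift m b) = rshift m (iter k (@ordS j) b).
  by rewrite !permX; elim: k => //= k ->; rewrite add_cycle_rshift.
apply/setP => y; apply/porbitP/imsetP => [[k ->]|[z _ ->]].
  by exists (iter k (@ordS j) b); rewrite ?inE ?E.
exists (z + (j - b))%N; rewrite E; congr rshift; apply: val_inj;
  rewrite /= iter_ordS.
by rewrite addnCA subnKC ?modnDr ?modn_small // ltnW.
Qed.

Hypothesis j_gt0 : (0 < j)%N.

Lemma num_cycles_add_cycle l s : num_cycles l (add_cycle s) =
  (num_cycles l s + (l == j))%N.
Proof.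
case: l => [|l]; first by rewrite !num_cycles0 eq_sym -[(_ == _)%N]negbK -lt0n
  j_gt0.
apply/eqP; rewrite -(eqn_pmul2r (ltn0Sn l)) mulnDl !num_cycles_mul.
rewrite -!sum1_card !big_mkcond big_split_ord /=; apply/eqP; congr (_ + _)%N.
  rewrite [RHS]big_mkcond; apply: eq_bigr => a _;
    rewrite !inE porbit_add_cycle_l card_imset //; exact: lshift_inj.
have E b : #|porbit (add_cycle s) (rshift m b)| = j.
  by rewrite porbit_add_cycle_r card_imset ?card_ord //; exact: rshift_inj.
under eq_bigr => b _ do rewrite inE E.
rewrite sum_nat_const card_ord eq_sym.
by case: eqP => [->|]; rewrite ?muln1 ?mul1n ?muln0.
Qed.

(** The values of [p] on the last [j] points are determined by the first of them, which may be any
    point on a [j]-cycle of [w]; completing [p] on the other [m] points then leaves [m] factorial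
    choices. *)
Lemma card_cycle_marks (w : 'S_(m + j)) :
  #|[set p : 'S_(m + j) | [forall b, w (p (rshift m b)) == p (rshift m (ordS
    b))]]|
  = (num_cycles j w * j * m`!)%N.
Proof.
pose b0 := Ordinal j_gt0.
have iterP (p : 'S_(m + j)) : [forall b, w (p (rshift m b)) == p (rshift m
  (ordS b))] ->
    forall k, iter k w (p (rshift m b0)) = p (rshift m (iter k (@ordS j) b0)).
  by move=> /forallP hp; elim=> //= k ->; rewrite (eqP (hp _)).
rewrite num_cycles_mul -sum_nat_const -sum1_card.
rewrite (partition_big (fun p : 'S_(m + j) =>
  p (rshift m b0)) (mem [set x | #|porbit w x| == j])) /=; last first.
  move=> p; rewrite !inE => hp.
  suff -> : porbit w (p (rshift m b0)) = [set p (rshift m b) | b : 'I_j].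
    by rewrite card_imset ?card_ord // => x y /perm_inj/rshift_inj.
  apply/setP => y; apply/porbitP/imsetP => [[k ->]|[z _ ->]].
    by rewrite permX iterP //; exists (iter k (@ordS j) b0).
  exists z; rewrite permX iterP //; congr (p (rshift _ _)); apply: val_inj.
  by rewrite /= iter_ordS add0n modn_small.
apply: eq_bigr => x; rewrite inE => /eqP xj.
have fI : injective (fun b : 'I_j => iter b w x).
  move=> a b /eqP; rewrite -!(nth_traject w _ x (n :=
    j)) // nth_uniq ?size_traject //.
    by move/eqP/val_inj.
  by have := uniq_traject_porbit w x; rewrite xj.
rewrite sum1_card -(card_perm_extend fI); apply: eq_card => p;
  rewrite unfold_in !inE.
apply/andP/forallP => [[hp /eqP <-] b|hp].
  rewrite iterP //; apply/eqP; congr (p (rshift _ _)); apply: val_inj.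
  by rewrite /= iter_ordS add0n modn_small.
split; last by rewrite (eqP (hp b0)).
apply/forallP => b; rewrite (eqP (hp _)) (eqP (hp (ordS b))) -iterS.
have -> : nat_of_ord (ordS b) = (b.+1 %% j)%N by [].
have [bj|bj] := eqVneq b.+1 j; first by rewrite bj modnn;
  have := iter_porbit w x; rewrite xj => ->.
by rewrite modn_small // ltn_neqAle bj ltn_ord.
Qed.

(* Double counting of the pairs of a permutation [w] and a [p] whose values on
   the last [j] points run along a [j]-cycle of [w]. *)
Lemma sum_num_cycles (R : comNzRingType) (g : 'S_(m + j) -> R) :
  (forall w t, g (w ^ t)%g = g w) ->
  \sum_w (num_cycles j w * j * m`!)%:R * g w =
    (m + j)`!%:R * \sum_s g (add_cycle s).
Proof.
move=> gJ; transitivity (\sum_(w : 'S_(m + j)) \sum_(p : 'S_(m + j) | [forall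
  b, w (p (rshift m b)) == p (rshift m (ordS b))]) g w).
  apply: eq_bigr => w _; rewrite sumr_const -card_cycle_marks mulr_natl.
  by congr (_ *+ _); apply: eq_card => p; rewrite inE.
rewrite (exchange_big_dep predT) //= -card_Sn -sum1_card natr_sum mulr_suml.
(* Conjugation by [p] turns the marking condition into one independent of [p]: the permutation
   rotates the last [j] points, that is, it is some [add_cycle j s]. *)
apply: eq_bigr => p _; rewrite mul1r (reindex_inj (@conjg_inj _ p)) /=.
transitivity (\sum_(w in [set add_cycle s | s : 'S_m]) g w); last first.
  by rewrite big_imset //= => s t _ _; exact: add_cycle_injective.
apply: eq_big => [w|w _]; last by rewrite gJ.
have E x : (w ^ p)%g (p x) = p (w x) by rewrite conjgE !permM permK.
apply/forallP/imsetP => [h|[s _ ->] b];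
  last by rewrite conjgE !permM permK add_cycle_rshift.
have [|s ->] := @add_cycle_surj w; last by exists s.
by move=> b; have := h b; rewrite E => /eqP/perm_inj.
Qed.

End AddCycle.
End CycleCounts.

(** * The Artin basis over the symmetric polynomials *)

Section ArtinBasis.
Local Open Scope ring_scope.

Variables (R : idomainType) (n : nat).
Local Notation A := {mpoly R[n.+1]}.
Implicit Types (p q : A) (f g : {poly A}).

Definition mvar (i : nat) : A := 'X_(inord i).

Lemma msym_var (s : 'S_n.+1) i : msym s ('X_i : A) = 'X_(s i).
Proof.
rewrite msymX; congr 'X_[_]; apply/mnmP => j; rewrite !mnmE.
by congr (nat_of_bool _); apply/eqP/eqP => [->|<-]; rewrite ?permKV ?permK.
Qed.

Definition sym_from (i : nat) p := forall s : 'S_n.+1,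
  (forall j : 'I_n.+1, (j < i)%N -> s j = j) -> msym s p = p.

Lemma mvar_inj i j : (i < n.+1)%N -> (j < n.+1)%N -> mvar i = mvar j -> i = j.
Proof.
move=> hi hj /(congr1 (mcoeff U_(inord i))); rewrite !mcoeffXU eqxx.
case: eqP => [/(congr1 val)/=|_ /eqP]; last by rewrite oner_eq0.
by rewrite !inordK.
Qed.

(** Exchanging [mvar i] with a later variable fixes every [c k], so the polynomial with these
    coefficients vanishes at the [n.+1 - i] distinct variables from index [i] on. This exceeds its
    degree. *)
Lemma sym_from_indep i (c : 'I_(n.+1 - i) -> A) : (i < n.+1)%N ->
  (forall k, sym_from i (c k)) -> \sum_k c k * mvar i ^+ k = 0 ->
    forall k, c k = 0.
Proof.
move=> lt_in sc e.
pose cn k := if insub k is Some o then c o else 0.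
pose f := \poly_(k < n.+1 - i) cn k.
have f_eval x : f.[x] = \sum_k c k * x ^+ k.
  rewrite horner_poly; apply: eq_bigr => k _; congr (_ * _).
  by rewrite /cn valK.
have f0 : f = 0.
  apply: (@roots_geq_poly_eq0 _ _ [seq mvar (i + k) | k <- iota 0 (n.+1 - i)]).
  - apply/allP => x /mapP[k]; rewrite mem_iota => /andP[_ hk] ->.
    have hik : (i + k < n.+1)%N by rewrite add0n ltn_subRL in hk.
    rewrite /root f_eval.
    have := congr1 (msym (tperm (inord i) (inord (i + k)))) e.
    rewrite msym0 raddf_sum /= => e'; apply/eqP; rewrite -[RHS]e';
      apply: eq_bigr => l _.
    rewrite msymM rmorphXn /= msym_var tpermL sc // => j hj.
    rewrite tpermD // -val_eqE /= inordK //; apply/eqP => hji; move: hj;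
      rewrite -hji ?ltnn //.
    by rewrite ltnNge leq_addr.
  - rewrite map_inj_in_uniq ?iota_uniq // => k l;
    rewrite !mem_iota !add0n => /andP[_ hk] /andP[_ hl].
    move/mvar_inj; rewrite -!ltn_subRL => /(_ hk hl)/eqP.
    by rewrite eqn_add2l => /eqP.
  - by rewrite size_map size_iota size_poly.
move=> k; have := congr1 (fun g : {poly A} => g`_k) f0.
by rewrite coef_poly ltn_ord coef0 /cn valK.
Qed.

(** Exponent vectors of the Artin monomials in the first [i] variables: the exponent of variable
    [i'] stays below [n.+1 - i']. Nested pairs allow the last variable to be split off by
    computation. *)
Fixpoint artin (i : nat) : finType :=
  if i is i'.+1 then (artin i' * 'I_(n.+1 - i'))%type else unit.

Fixpoint amon (i : nat) : artin i -> A :=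
  if i is i'.+1 then fun a => amon a.1 * mvar i' ^+ a.2 else fun=> 1.

Fixpoint adeg (i : nat) : artin i -> nat :=
  if i is i'.+1 then fun a => (adeg a.1 + a.2)%N else fun=> 0%N.

Lemma sum_artinS i (F : artin i.+1 -> A) :
  \sum_a F a = \sum_(k : 'I_(n.+1 - i)) \sum_a F (a, k).
Proof. by rewrite exchange_big pair_big /=; apply: eq_bigr => -[]. Qed.

Lemma amon_homog i (a : artin i) : amon a \is (adeg a).-homog.
Proof.
elim: i a => [|i IH] a /=; first exact: dhomog1.
apply: dhomogM; first exact: IH.
by rewrite -[X in X.-homog]mul1n; apply: dhomogMn; rewrite dhomogX /= mdeg1.
Qed.

Lemma amon_sym_from i (a : artin i) : (i <= n.+1)%N -> sym_from i (amon a).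
Proof.
elim: i a => [|i IH] a hi s hs /=; first by rewrite msym1.
rewrite msymM (IH _ (ltnW hi)) => [|j hj]; last exact/hs/(ltn_trans hj).
by rewrite rmorphXn /= msym_var hs // inordK.
Qed.

(** Collect the terms by powers of the last variable. The coefficients are combinations of monomials
    in the earlier variables with symmetric coefficients, so [sym_from_indep] makes them vanish, and
    induction applies to each. *)
Lemma amon_indep i (s : artin i -> A) : (i <= n.+1)%N ->
  (forall a, s a \is symmetric) -> \sum_a s a * amon a = 0 -> forall a, s a = 0.
Proof.
elim: i s => [|i IH] s hi ss.
  by rewrite /= (bigD1 tt) //= big1 ?addr0 ?mulr1 => [e []|[]].
rewrite sum_artinS /= => e [a k].
pose c (k : 'I_(n.+1 - i)) := \sum_a s (a, k) * amon a.
have c0 : c k = 0.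
  move: k; apply: (sym_from_indep hi) => [k t ht|].
    rewrite /c raddf_sum /=; apply: eq_bigr => b _;
      rewrite msymM (amon_sym_from _ (ltnW hi)) //.
    by rewrite (issymP _ (ss _)).
  by rewrite -[RHS]e; apply: eq_bigr => k _; rewrite mulr_suml;
    apply: eq_bigr => b _; rewrite mulrA.
exact: (IH (fun a => s (a, k)) (ltnW hi) (fun a => ss _) c0 a).
Qed.

(* The ring generated by the symmetric polynomials and the first [i] variables;
   that it is a ring is [tower_all]. *)
Fixpoint tower (i : nat) (p : A) : Prop :=
  if i is i'.+1 then exists2 c : 'I_(n.+1 - i') -> A,
    forall k, tower i' (c k) & p = \sum_k c k * mvar i' ^+ k
  else p \is symmetric.

(** The monic equation of [mvar i] over [tower i]: its degree [n.+1 - i] is exactly the bound on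
    exponents in the Artin basis. *)
Definition tail_poly i : {poly A} := \prod_(i <= j < n.+1) ('X - (mvar j)%:P).

Lemma tail_poly_monic i : tail_poly i \is monic.
Proof. exact: monic_prod_XsubC. Qed.

Lemma size_tail_poly i : size (tail_poly i) = (n.+1 - i).+1.
Proof. by rewrite size_prod_XsubC size_iota. Qed.

Lemma tail_polyS i : (i < n.+1)%N ->
  tail_poly i = ('X - (mvar i)%:P) * tail_poly i.+1.
Proof. by move=> h; rewrite /tail_poly big_ltn. Qed.

Lemma tail_poly_root i : (i < n.+1)%N -> (tail_poly i).[mvar i] = 0.
Proof. by move=> h; rewrite tail_polyS // hornerM hornerXsubC subrr mul0r. Qed.

Lemma tail_poly0_sym k : (tail_poly 0)`_k \is symmetric.
Proof.
apply/issymP => s; rewrite -[LHS](coef_map (msym s)).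
suff -> : map_poly (msym s) (tail_poly 0) = tail_poly 0 by [].
rewrite /tail_poly big_mkord rmorph_prod /=.
rewrite [RHS](reindex_inj (@perm_inj _ s)) /=; apply: eq_bigr => j _.
by rewrite rmorphB /= map_polyX map_polyC /= /mvar !inord_val msym_var.
Qed.

Definition tower_ring i := [/\ forall p q, tower i p -> tower i q ->
  tower i (p - q),
  forall p q, tower i p -> tower i q ->
    tower i (p * q) & forall p, p \is symmetric -> tower i p].

Section TowerStep.
Variable i : nat.
Hypotheses (lt_in : (i < n.+1)%N) (tring : tower_ring i)
  (tail : forall k, tower i (tail_poly i)`_k).

Let tB := let: And3 h _ _ := tring in h.
Let tM := let: And3 _ h _ := tring in h.
Let tS := let: And3 _ _ h := tring in h.
Let t0 : tower i 0. Proof. exact/tS/rpred0. Qed.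
Let tD p q : tower i p -> tower i q -> tower i (p + q).
Proof. by move=> hp hq; rewrite -[q]opprK; apply: tB => //; rewrite -sub0r;
  apply: tB. Qed.

Definition tower_poly f := forall k, tower i f`_k.

Lemma tower_polyB f g : tower_poly f -> tower_poly g -> tower_poly (f - g).
Proof. by move=> hf hg k; rewrite coefB; apply: tB. Qed.

Lemma tower_polyM f g : tower_poly f -> tower_poly g -> tower_poly (f * g).
Proof.
move=> hf hg k; rewrite coefM; elim/big_ind: _ => // l _; exact: tM.
Qed.

(** Division by [tail_poly i]: subtracting a multiple with the same leading term lowers the size and
    does not change the value at the root [mvar i]. *)
Lemma tower_eval f : tower_poly f -> tower i.+1 f.[mvar i].
Proof.
have [m] := ubnP (size f); elim: m f => // m IH f; rewrite ltnS => szf hf.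
case: (ssrnat.leqP (size f) (n.+1 - i)) => [hs|hs].
  exists (fun k : 'I_(n.+1 - i) => f`_k) => [k|]; first exact: hf.
  by rewrite (horner_coef_wide _ hs).
pose g := lead_coef f *: 'X^(size f - (n.+1 - i).+1) * tail_poly i.
have f0 : f != 0 by apply: contraTneq hs => ->; rewrite size_poly0 ltn0.
have gM : tower_poly g.
  apply: tower_polyM => // k; rewrite coefZ coefXn; case: eqP => _;
    rewrite ?mulr1 ?mulr0 //.
  exact: hf.
have szg : size g = size f.
  rewrite size_Mmonic ?tail_poly_monic //; last first.
    by rewrite -size_poly_eq0 size_scale ?lead_coef_eq0 // size_polyXn.
  rewrite size_scale ?lead_coef_eq0 // size_polyXn size_tail_poly addSn /=
    subnK //.
have lcg : lead_coef g = lead_coef f.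
  by rewrite lead_coefM (monicP (tail_poly_monic i)) mulr1 lead_coefZ
    lead_coefXn mulr1.
suff : tower i.+1 (f - g).[mvar i].
  by rewrite hornerD hornerN hornerM (tail_poly_root lt_in) mulr0 subr0.
apply: IH; last exact: tower_polyB.
apply: leq_trans szf; rewrite -[size f]prednK ?lt0n ?size_poly_eq0 // ltnS.
apply/leq_sizeP => k; rewrite leq_eqVlt => /orP[/eqP<-|hk].
  by rewrite coefB -/(lead_coef f) -szg -/(lead_coef g) lcg subrr.
by rewrite coefB !nth_default ?subrr // ?szg; move: hk;
  rewrite prednK // lt0n size_poly_eq0.
Qed.

Lemma tower_evalP p : tower i.+1 p -> exists2 f, tower_poly f & p = f.[mvar i].
Proof.
move=> [c hc ->]; exists (\poly_(k < n.+1 - i) (if insub k is Some o then c o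
  else 0)).
  by move=> k; rewrite coef_poly; case: ifP => // _; case: insubP => // o _ _;
    exact: hc.
by rewrite horner_poly; apply: eq_bigr => k _; rewrite valK.
Qed.

Lemma tower_step : tower_ring i.+1 /\ forall k, tower i.+1 (tail_poly i.+1)`_k.
Proof.
have tup p : tower i p -> tower i.+1 p.
  move=> hp; rewrite -[p](hornerC p (mvar i)); apply: tower_eval => k.
  by rewrite coefC; case: eqP.
have tX : tower i.+1 (mvar i).
  rewrite -[mvar i]hornerX; apply: tower_eval => k; rewrite coefX; apply: tS.
  exact: rpred_nat.
have tr : tower_ring i.+1.
  split=> [p q /tower_evalP[f hf ->] /tower_evalP[g hg ->]|p q /tower_evalP[f
    hf ->] /tower_evalP[g hg ->]|p hp].
  - by rewrite -hornerN -hornerD; apply/tower_eval/tower_polyB.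
  - by rewrite -hornerM; apply/tower_eval/tower_polyM.
  - exact/tup/tS.
split=> // k; have [hB hM _] := tr.
(* Synthetic division by ['X - x_i]: coefficient k of the quotient is coefficient k+1 of
   [tail_poly i] plus x_i times coefficient k+1 of the quotient. Hence an induction downwards from
   the leading coefficient. *)
have [m] := ubnP (n.+2 - k); elim: m k => // m IH k hm.
case: (ssrnat.leqP (size (tail_poly i.+1)) k) => hk;
  first by rewrite nth_default //; exact: tup.
have := congr1 (fun g : {poly A} => g`_k.+1) (tail_polyS lt_in).
rewrite mulrBl coefB coefXM coefCM /= => /esym/eqP; rewrite subr_eq => /eqP->.
rewrite -[_ * _]opprK; apply: (hB); first exact: tup.
rewrite -sub0r; apply: (hB); first exact: tup.
apply: (hM) => //; apply: IH.
move: hk hm; rewrite size_tail_poly; lia.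
Qed.
End TowerStep.

Lemma tower_all i : (i <= n.+1)%N ->
  tower_ring i /\ forall k, tower i (tail_poly i)`_k.
Proof.
elim: i => [_|i IH hi]; last by have [h1 h2] := IH (ltnW hi); exact: tower_step.
split; last exact: tail_poly0_sym.
by split=> //= p q hp hq; rewrite ?rpredB ?rpredM.
Qed.

Lemma tower_span i p : tower i p ->
  exists2 s : artin i -> A, (forall a, s a \is symmetric) & p =
    \sum_a s a * amon a.
Proof.
elim: i p => [|i IH] p /=.
  by move=> hp; exists (fun=> p) => //;
    rewrite (bigD1 tt) //= big1 ?addr0 ?mulr1 // => -[].
move=> [c hc ->]; have /fin_all_exists2[s hs cE] k := IH _ (hc k).
exists (fun a => s a.2 a.1) => [a|]; first exact: hs.
rewrite sum_artinS; apply: eq_bigr => k _; rewrite {1}cE mulr_suml.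
by apply: eq_bigr => a _; rewrite mulrA.
Qed.

Lemma amon_span p :
  exists2 s : artin n.+1 -> A, (forall a, s a \is symmetric) & p =
    \sum_a s a * amon a.
Proof.
apply: tower_span.
have tX j i : (j < i)%N -> (i <= n.+1)%N -> tower i (mvar j).
  elim: i => // i IH; rewrite ltnS leq_eqVlt => ji hi.
  have [tr tt] := tower_all (ltnW hi).
  have h f := @tower_eval _ hi tr tt f; have [_ _ tS] := tr.
  case/orP: ji => [/eqP->|ji].
    rewrite -[mvar i]hornerX; apply: h => k; rewrite coefX; apply: tS;
      exact: rpred_nat.
  rewrite -[mvar j](hornerC _ (mvar i)); apply: h => k; rewrite coefC;
    case: eqP => _; last exact/tS/rpred0.
  exact: IH ji (ltnW hi).
have [[tB tM tS] _] := tower_all (leqnn n.+1).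
have tD q r : tower n.+1 q -> tower n.+1 r -> tower n.+1 (q + r).
  move=> hq hr; rewrite -[r]opprK; apply: (tB) => //; rewrite -sub0r;
    apply: (tB) => //.
  exact/tS/rpred0.
rewrite (mpolyE p); elim/big_ind: _ => [|q r|m _]; [exact/tS/rpred0|exact: tD|].
rewrite -mul_mpolyC; apply: (tM).
  by apply: tS; apply/issymP => s; rewrite /msym mmapC.
rewrite mpolyXE_id; elim/big_ind: _ => [|q r|j _]; [exact/tS/rpred1|exact: tM|].
elim: (m j) => [|l IH]; first exact/tS/rpred1.
rewrite exprS; apply: tM => //; rewrite -[j]inord_val; exact: tX.
Qed.

End ArtinBasis.
Arguments artin : simpl never.
Arguments amon : simpl never.
Arguments adeg : simpl never.

(** * Coordinates and traces *)

Section Coordinates.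
Local Open Scope ring_scope.

Variables (R : idomainType) (n : nat).
Local Notation A := {mpoly R[n.+1]}.
Local Notation I := (artin n n.+1).
Local Notation mon := (@amon R n n.+1).
Local Notation deg := (@adeg n n.+1).
Local Notation S := [tuple mesym n.+1 R i.+1 | i < n.+1].
Implicit Types (p q : A).

Definition acoord p : I -> A := sval (cid2 (amon_span p)).

Lemma acoord_sym p a : acoord p a \is symmetric.
Proof. by rewrite /acoord; case: cid2 => s hs e /=. Qed.

Lemma acoordE p : p = \sum_a acoord p a * mon a.
Proof. by rewrite /acoord; case: cid2 => s hs e /=. Qed.

Lemma acoord_sum (s : I -> A) a : (forall b, s b \is symmetric) ->
  acoord (\sum_b s b * mon b) a = s a.
Proof.
move=> hs; apply/eqP; rewrite -subr_eq0; apply/eqP; move: a.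
apply: (@amon_indep R n n.+1 (fun a =>
  acoord (\sum_b s b * mon b) a - s a)) => // [a|].
  by rewrite rpredB ?acoord_sym.
under eq_bigr do rewrite mulrBl.
by rewrite sumrB -acoordE subrr.
Qed.

Lemma acoordD p q a : acoord (p + q) a = acoord p a + acoord q a.
Proof.
rewrite {1}(acoordE p) {1}(acoordE q) -big_split /=.
under eq_bigr do rewrite -mulrDl.
by rewrite acoord_sum // => b; rewrite rpredD ?acoord_sym.
Qed.

Lemma acoordM s p a : s \is symmetric -> acoord (s * p) a = s * acoord p a.
Proof.
move=> hs; rewrite {1}(acoordE p) mulr_sumr.
under eq_bigr do rewrite mulrA.
by rewrite acoord_sum // => b; rewrite rpredM ?acoord_sym.
Qed.

Lemma acoord0 a : acoord 0 a = 0.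
Proof. by rewrite -[0 in LHS](mul0r 0) acoordM ?mul0r ?rpred0. Qed.

Lemma acoord_bigsum (J : Type) (r : seq J) (P : pred J) (F : J -> A) a :
  acoord (\sum_(j <- r | P j) F j) a = \sum_(j <- r | P j) acoord (F j) a.
Proof.
by elim/big_rec2: _ => [|j x y _ <-]; rewrite ?acoord0 ?acoordD.
Qed.

Lemma pihomogM d e p q : q \is e.-homog ->
  pihomog mdeg d (p * q) = if (e <= d)%N then pihomog mdeg (d - e) p * q else 0.
Proof.
move=> hq; rewrite {1}(pihomog_partitionE (leqnn (msize p))) mulr_suml
  raddf_sum /=.
have E (l : 'I_(msize p)) : pihomog mdeg d (pihomog mdeg l p * q) =
    if (l + e == d)%N then pihomog mdeg l p * q else 0.
  have h : pihomog mdeg l p * q \is (l + e).-homog by rewrite dhomogM ?pihomogP.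
  case: eqP => [<-|/eqP hd]; first by rewrite pihomog_dE.
  exact: pihomog_ne0 hd h.
under eq_bigr do rewrite E.
case: ifP => he; last first.
  by rewrite big1 // => l _; case: eqP => // hl; rewrite -hl leq_addl in he.
rewrite -big_mkcond /=; case: (ssrnat.ltnP (d - e) (msize p)) => hs.
  rewrite (big_pred1 (Ordinal hs)) // => l /=; rewrite -val_eqE /=; lia.
rewrite big_pred0; last by move=> l; move: (ltn_ord l); lia.
suff -> : pihomog mdeg (d - e) p = 0 by rewrite mul0r.
rewrite pihomogE big_seq_cond big_pred0 // => m;
  apply/negP => /andP[/msize_mdeg_lt h /eqP h'].
by rewrite h' ltnNge hs in h.
Qed.

(** Keeping only the part of degree [d - deg a] of each coordinate yields another expansion of [p];
    by uniqueness nothing was discarded. *)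
Lemma acoord_homog d p a : p \is d.-homog ->
  if (deg a <= d)%N then acoord p a \is (d - deg a).-homog else acoord p a == 0.
Proof.
move=> hp; pose s a := if (deg a <= d)%N then pihomog mdeg (d - deg a) (acoord
  p a) else 0.
have -> : acoord p a = s a.
  rewrite -[in LHS](pihomog_dE hp) {1}(acoordE p) raddf_sum /=.
  rewrite -[RHS]acoord_sum => [|b]; last first.
    by rewrite /s; case: ifP; rewrite ?rpred0 // => _;
      apply/pihomog_sym/acoord_sym.
  congr (acoord _ _); apply: eq_bigr => b _;
    rewrite (pihomogM _ _ (@amon_homog R n n.+1 b)).
  by rewrite /s; case: ifP; rewrite ?mul0r.
by rewrite /s; case: (deg a <= d)%N => //; exact: pihomogP.
Qed.

Lemma homog0_const p : p \is 0.-homog -> p = (p@_0%MM)%:MP.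
Proof.
move=> /dhomogP hp; apply/mpolyP => m; rewrite mcoeffC.
have [->|m0] := eqVneq m 0%MM; first by rewrite mulr1.
rewrite mulr0; apply/eqP; rewrite mcoeff_eq0; apply/negP => /hp/eqP.
by rewrite /= mdeg_eq0 (negPf m0).
Qed.


Lemma esym_comp_sym p : p \mPo S \is symmetric.
Proof.
by apply: mcomp_sym => i; rewrite -tnth_nth tnth_mktuple mesym_sym.
Qed.

Lemma symf_comp p : symf (p \mPo S) = p.
Proof. by apply: msym_fundamental_un; rewrite -symfP // esym_comp_sym. Qed.

Lemma symf_sum (J : Type) (r : seq J) (P : pred J) (F : J -> A) :
  (forall j, F j \is symmetric) ->
  symf (\sum_(j <- r | P j) F j) = \sum_(j <- r | P j) symf (F j).
Proof.
move=> hF; apply: msym_fundamental_un;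
  rewrite -symfP ?rpred_sum // raddf_sum /=.
by apply: eq_bigr => j _; exact: symfP.
Qed.

End Coordinates.

Section Traces.
Local Open Scope ring_scope.

Variables (K : fieldType) (V : lmodType K).

(* [b] restricted to [P] is a basis of [W], with coordinate functions [c]. *)
Definition frame (W : set V) (I : finType) (P : pred I) (b : I ->
  V) (c : I -> V -> K) :=
  [/\ forall i, P i -> W (b i),
      forall w, W w -> w = \sum_(i | P i) c i w *: b i
    & forall (g : I -> K) i, P i -> c i (\sum_(j | P j) g j *: b j) = g i].

(** The trace does not depend on the basis. It is needed twice: [trace_on] selects an arbitrary
    basis, and Molien's formula compares two explicit ones with different index types. *)
Lemma frame_trace (W : set V) (f : V ->
  V) (I J : finType) (P : pred I) (Q : pred J)
    (b : I -> V) (c : I -> V -> K) (b' : J -> V) (c' : J -> V -> K) :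
  (forall (L : finType) (X : pred L) (g : L -> K) (v : L -> V),
     f (\sum_(i | X i) g i *: v i) = \sum_(i | X i) g i *: f (v i)) ->
  (forall w, W w -> W (f w)) -> frame W P b c -> frame W Q b' c' ->
  \sum_(i | P i) c i (f (b i)) = \sum_(j | Q j) c' j (f (b' j)).
Proof.
move=> flin fW [bW bE bc] [bW' bE' bc'].
have lin i g : P i -> c i (\sum_(j | Q j) g j *: b' j) =
  \sum_(j | Q j) g j * c i (b' j).
  move=> Pi; rewrite (eq_bigr (fun j =>
    \sum_(l | P l) (g j * c l (b' j)) *: b l)); last first.
    move=> j Qj; rewrite {1}[b' j]bE ?scaler_sumr; last exact: bW'.
    by apply: eq_bigr => l _; rewrite scalerA.
  rewrite exchange_big /=; under eq_bigr do rewrite -scaler_suml.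
  by rewrite bc.
have lin' j g : Q j -> c' j (\sum_(i | P i) g i *: f (b i)) =
  \sum_(i | P i) g i * c' j (f (b i)).
  move=> Qj; rewrite (eq_bigr (fun i =>
    \sum_(l | Q l) (g i * c' l (f (b i))) *: b' l)); last first.
    move=> i Pi; rewrite {1}[f (b i)]bE' ?scaler_sumr; last exact/fW/bW.
    by apply: eq_bigr => l _; rewrite scalerA.
  rewrite exchange_big /=; under eq_bigr do rewrite -scaler_suml.
  by rewrite bc'.
rewrite (eq_bigr (fun i => \sum_(j | Q j) c' j (f (b i)) * c i (b' j)));
  last first.
  by move=> i Pi; rewrite -lin // -bE' //; exact/fW/bW.
rewrite exchange_big /=; apply: eq_bigr => j Qj.
rewrite (eq_bigr (fun i => c i (b' j) * c' j (f (b i)))); last by move=> i _;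
  rewrite mulrC.
rewrite -lin' // -flin -bE //; exact: bW'.
Qed.

Lemma basis_frame (W : set V) d (b : 'I_d -> V) :
  (forall (g : 'I_d -> K), W (\sum_j g j *: b j)) -> is_basis W b ->
  exists c, frame W predT b c.
Proof.
move=> Wsum [bW bU].
(* [is_basis] provides coordinates on [W] only; outside [W] they are set to 0. *)
pose c i v := match pselect (W v) with left Wv =>
  sval (cid (bU v Wv)) 0 i | _ => 0 end.
have cE v (Wv : W v) : v = \sum_j c j v *: b j.
  rewrite {1}(proj1 (svalP (cid (bU v Wv)))); apply: eq_bigr => j _;
    congr (_ *: _).
  rewrite /c; case: pselect => // Wv'; congr (sval (cid (bU v _)) 0 j).
  exact: Prop_irrelevance.
exists c; split=> // g i _.
rewrite /c; case: pselect => // Wv; case: cid => x [xE xU] /=.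
by rewrite (xU (\row_j g j)) ?mxE //; apply: eq_bigr => j _; rewrite mxE.
Qed.

Lemma trace_onE (W : set V) (f : V ->
  V) (I : finType) (P : pred I) (b : I -> V) (c : I -> V -> K) :
  (forall (L : finType) (X : pred L) (g : L -> K) (v : L -> V),
     f (\sum_(i | X i) g i *: v i) = \sum_(i | X i) g i *: f (v i)) ->
  (forall w, W w -> W (f w)) ->
  (forall (L : finType) (X : pred L) (g : L -> K) (v : L -> V),
     (forall i, X i -> W (v i)) -> W (\sum_(i | X i) g i *: v i)) ->
  frame W P b c -> trace_on W f = \sum_(i | P i) c i (f (b i)).
Proof.
move=> flin fW Wsum Fr; have [bW bE bc] := Fr.
rewrite /trace_on; case: xgetP => [t _ [d [b' [M [b'P fb' ->]]]]|].
  have [|c' Fr'] := basis_frame _ b'P.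
    by move=> g; apply: Wsum => i _; case: b'P.
  rewrite (frame_trace flin fW Fr Fr') /mxtrace; apply: eq_bigr => j _.
  by rewrite fb'; case: Fr' => _ _ h; rewrite (h (fun i => M i j)).
(* The default of [xget] is excluded: enumerating [P] turns the frame into a basis indexed by
   ordinals. *)
move=> /(_ (\sum_(i | P i) c i (f (b i)))) [].
pose e (j : 'I_#|P|) := enum_val j.
have eP j : P (e j) by exact: (enum_valP j).
have eW (j : 'I_#|P|) : W (b (e j)) by exact: bW.
exists #|P|, (fun j => b (e j)), (\matrix_(i, j) c (e i) (f (b (e j)))).
have sumE (U : zmodType) (g : I -> U) : \sum_(i | P i) g i = \sum_j g (e j).
  by rewrite (eq_bigl (mem P)) // big_enum_val.
split; last by rewrite sumE; apply: eq_bigr => j _; rewrite mxE.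
  split=> // w Ww; exists (\row_j c (e j) w); split=> [|x xE].
    by rewrite {1}(bE _ Ww) sumE; apply: eq_bigr => j _; rewrite mxE.
  apply/rowP => j; rewrite mxE xE.
  rewrite [X in c _ X](_ : _ = \sum_(i | P i) (x 0 (enum_rank_in (eP j) i)) *:
    b i).
    by rewrite bc // enum_valK_in.
  by rewrite sumE; apply: eq_bigr => i _; rewrite enum_valK_in.
move=> j; rewrite {1}(bE (f (b (e j)))); last exact/fW.
by rewrite sumE; apply: eq_bigr => i _; rewrite mxE.
Qed.

End Traces.

(** * The graded character of the coinvariant algebra *)

Section CoinvariantTrace.
Local Open Scope ring_scope.
Local Open Scope quotient_scope.

Variable n : nat.
Local Notation A := {mpoly rat[n.+1]}.
Local Notation I := (artin n n.+1).
Local Notation mon := (@amon rat n n.+1).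
Local Notation deg := (@adeg n n.+1).
Local Notation S := [tuple mesym n.+1 rat i.+1 | i < n.+1].
Local Notation cpi := (\pi_(coinv n.+1)).
Implicit Types (p q : A) (w : 'S_n.+1).

(** The diagonal entry of [w] at [a] in the coinvariant algebra: modulo the ideal, only the constant
    terms of the symmetric coordinates survive. *)
Definition alpha w (a : I) : rat := (acoord (msym w (mon a)) a)@_0%MM.

Lemma acoord_ideal p a : p \in @coinv_ideal n.+1 -> (acoord p a)@_0%MM = 0.
Proof.
move=> /coinv_idealP[m [f [g [gP ->]]]];
  rewrite acoord_bigsum raddf_sum /= big1 // => j _.
by rewrite mulrC acoordM ?(gP j).1 // rmorphM /= (gP j).2 mul0r.
Qed.

Definition coinv_coord (a : I) (x : coinv n.+1) : rat :=
  (acoord (generic_quotient.repr x) a)@_0%MM.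

Lemma coinv_coord_pi a p : coinv_coord a (cpi p) = (acoord p a)@_0%MM.
Proof.
have h : generic_quotient.repr (cpi p) - p \in @coinv_ideal n.+1.
  by rewrite Quotient.idealrBE generic_quotient.reprK.
by rewrite /coinv_coord -[generic_quotient.repr _](subrK p) acoordD raddfD /=
  (acoord_ideal _ h) add0r.
Qed.

Lemma coinv_scale_pi (c : rat) p : c *: cpi p = cpi (c *: p).
Proof. by rewrite -[c *: p]mul_mpolyC rmorphM. Qed.

Lemma coinv_quotP (x : coinv n.+1) : exists p, x = cpi p.
Proof. by exists (generic_quotient.repr x); rewrite generic_quotient.reprK. Qed.

Lemma coinv_actD w (x y : coinv n.+1) : coinv_act w (x + y) =
  coinv_act w x + coinv_act w y.
Proof.
have [p ->] := coinv_quotP x; have [q ->] := coinv_quotP y.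
by rewrite -raddfD /= !coinv_act_pi -raddfD /= msymD.
Qed.

Lemma coinv_actZ w c (x : coinv n.+1) : coinv_act w (c *: x) =
  c *: coinv_act w x.
Proof.
have [p ->] := coinv_quotP x.
by rewrite coinv_scale_pi !coinv_act_pi coinv_scale_pi msymZ.
Qed.

Lemma coinv_act0 w : coinv_act w (0 : coinv n.+1) = 0.
Proof. by rewrite -[0 in LHS](scale0r (0 : coinv n.+1)) coinv_actZ scale0r. Qed.

Lemma coinv_char_alpha d w : coinv_char d w =
  \sum_(a : I | deg a == d) alpha w a.
Proof.
have actsum (L : finType) (X : pred L) (g : L -> rat) (v : L -> coinv n.+1) :
    coinv_act w (\sum_(i | X i) g i *: v i) =
      \sum_(i | X i) g i *: coinv_act w (v i).
  elim/big_rec2: _ => [|i x y _ <-]; first exact: coinv_act0.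
  by rewrite coinv_actD coinv_actZ.
have actW x : @coinv_deg n.+1 d x -> coinv_deg d (coinv_act w x).
  move=> [p hp <-]; exists (msym w p); last by rewrite coinv_act_pi.
  by move: hp => /=; rewrite !homog_piE -msym_pihomog => /eqP->.
have Wsum (L : finType) (X : pred L) (g : L -> rat) (v : L -> coinv n.+1) :
    (forall i, X i -> coinv_deg d (v i)) ->
      coinv_deg d (\sum_(i | X i) g i *: v i).
  move=> hv; elim/big_ind: _ => [|x y [p hp <-] [q hq <-]|i Xi].
  - by exists 0; rewrite ?raddf0 //=; exact: dhomog0.
  - by exists (p + q); rewrite ?raddfD //=; exact: dhomogD.
  - by have [p hp <-] := hv i Xi; exists (g i *: p);
    rewrite ?coinv_scale_pi //=; exact: dhomogZ.
rewrite /coinv_char (trace_onE (P := fun a => deg a == d) (b :=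
  fun a => cpi (mon a)) (c := coinv_coord) actsum actW Wsum).
  by apply: eq_bigr => a _; rewrite coinv_act_pi coinv_coord_pi.
have cl g (a : I) : deg a == d ->
  coinv_coord a (\sum_(j | deg j == d) g j *: cpi (mon j)) = g a.
  move=> da; under eq_bigr do rewrite coinv_scale_pi.
  rewrite -raddf_sum coinv_coord_pi.
  rewrite (eq_bigr (fun b : I =>
    (if deg b == d then (g b)%:MP else 0) * mon b)); last first.
    by move=> b ->; rewrite mul_mpolyC.
  rewrite big_mkcond (eq_bigr (fun b : I =>
    (if deg b == d then (g b)%:MP else 0) * mon b)); last first.
    by move=> b _; case: (deg b == d); rewrite ?mul0r.
  rewrite acoord_sum ?da ?mcoeffC ?eqxx ?mulr1 // => b; case: ifP => _;
    last exact: rpred0.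
  by apply/issymP => s; rewrite /msym mmapC.
split=> //.
- by move=> a /eqP <-; exists (mon a) => //; exact: amon_homog.
- move=> _ [p hp <-]; rewrite {1}(acoordE p) raddf_sum /= [RHS]big_mkcond.
  apply: eq_bigr => a _; rewrite rmorphM /= coinv_coord_pi.
  (* The coordinate at [a] has degree [d - deg a]. It is a constant in degree 0, lies in the ideal
     in positive degree, and is zero if [deg a] exceeds [d]. *)
  have := acoord_homog a hp; rewrite leq_eqVlt orbC.
  case: ltngtP => [hd|hd|hd] /=; last 1 first.
  + rewrite hd subnn => /homog0_const h.
    by rewrite coinv_scale_pi -mul_mpolyC [RHS]rmorphM /= -h.
  + move=> h; suff -> : cpi (acoord p a) = 0 by rewrite mul0r.
    apply/eqP; rewrite -[0](raddf0 cpi) -Quotient.idealrBE subr0.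
    apply/coinv_idealP; exists 1%N, (fun=> 1), (fun=> acoord p a);
      rewrite big_ord1 mul1r.
    split=> // _; split; first exact: acoord_sym.
    apply: (dhomog_nemf_coeff h); rewrite /= mdeg0 eq_sym subn_eq0 -ltnNge //.
  + by move=> /eqP->; rewrite raddf0 mul0r.
Qed.

Definition chip w : {poly rat} := \sum_(a : I) alpha w a *: 'X^(deg a).

Lemma coef_chip w d : (chip w)`_d = coinv_char d w.
Proof.
rewrite coinv_char_alpha /chip coef_sum [RHS]big_mkcond; apply: eq_bigr => a _.
by rewrite coefZ coefXn eq_sym; case: eqP; rewrite ?mulr1 ?mulr0.
Qed.

Lemma amon1_exists i : (i <= n.+1)%N ->
  exists2 a : artin n i, amon rat a = 1 & adeg a = 0%N.
Proof.
elim: i => [|i IH] hi; first by exists (tt : artin n 0).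
have [a a1 d0] := IH (ltnW hi).
have hk : (0 < n.+1 - i)%N by rewrite subn_gt0.
exists ((a, Ordinal hk) : artin n i.+1);
  first by have -> : amon rat ((a, Ordinal hk) : artin n i.+1) =
  amon rat a * mvar rat n i ^+ 0 by []; rewrite a1 mulr1.
by have -> : adeg ((a, Ordinal hk) : artin n i.+1) = (adeg a + 0)%N by [];
  rewrite d0.
Qed.

(** The invariants of the coinvariant algebra are the constants: the sum of the conjugates of
    [mon a] is symmetric, so its only nonzero Artin coordinate can be at the monomial 1. This gives
    H_n(1) = 1. *)
Lemma sum_chip : \sum_w chip w = (n.+1)`!%:R.
Proof.
have [a0 m0 d0] := amon1_exists (leqnn n.+1).
rewrite /chip exchange_big /= (bigD1 a0) //= d0 [X in _ + X]big1 ?addr0 =>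
  [|a aa0].
  transitivity (\sum_(w : 'S_n.+1) (1 : {poly rat}));
    last by rewrite sumr_const card_Sn.
  apply: eq_bigr => w _; rewrite /alpha m0 msym1 -m0.
  rewrite [X in acoord X](_ : mon a0 = \sum_b (b == a0)%:R * mon b); last first.
    by rewrite (bigD1 a0) //= eqxx mul1r big1 ?addr0 // => b /negPf->;
      rewrite mul0r.
  rewrite acoord_sum ?eqxx ?mcoeff1 ?eqxx ?scale1r ?expr0 // => b.
  exact: rpred_nat.
rewrite -scaler_suml /alpha -raddf_sum -acoord_bigsum.
set s := \sum_w _; have hs : s \is symmetric.
  apply/issymP => t; rewrite /s raddf_sum /= [RHS](reindex_inj (mulIg t)).
  by apply: eq_bigr => w _; rewrite msymMm.
rewrite [X in acoord X](_ : s = \sum_b (if b == a0 then s else 0) * mon b);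
  last first.
  by rewrite (bigD1 a0) //= eqxx m0 mulr1 big1 ?addr0 // => b /negPf->;
    rewrite mul0r.
rewrite acoord_sum ?(negPf aa0) ?raddf0 ?scale0r // => b.
by case: ifP => // _; exact: rpred0.
Qed.

(** * Two bases of the polynomials of a given degree *)

Section Molien.
Variables (w : 'S_n.+1) (N d : nat).
Hypothesis lt_dN : (d < N)%N.

Definition mnm_of M (r : {ffun 'I_n.+1 -> 'I_M}) : 'X_{1..n.+1} :=
  [multinom (r i : nat) | i < n.+1].

Lemma mnm_of_inj M : injective (@mnm_of M).
Proof.
by move=> r s /mnmP e; apply/ffunP => i; apply: val_inj; have := e i;
  rewrite !mnmE.
Qed.

Lemma mdeg_mnm_of M (r : {ffun 'I_n.+1 ->
  'I_M}) : mdeg (mnm_of r) = (\sum_i r i)%N.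
Proof. by rewrite mdegE; apply: eq_bigr => i _; rewrite mnmE. Qed.

Lemma mnmwgt_mnm_of M (r : {ffun 'I_n.+1 ->
  'I_M}) : mnmwgt (mnm_of r) = (\sum_i r i * i.+1)%N.
Proof. by apply: eq_bigr => i _; rewrite mnmE. Qed.

(** The inequality bounds each exponent by [k], so exponents in ['I_N] suffice. It holds for the
    degree and for the weight [mnmwgt], which gives a variable the degree of the elementary
    symmetric polynomial to be substituted for it. *)
Lemma homog_expand (mf : measure n.+1) k p : (forall m, (mdeg m <= mf m)%N) ->
  (k < N)%N ->
  p \is k.-homog for mf ->
  p = \sum_(u : {ffun 'I_n.+1 ->
    'I_N} | mf (mnm_of u) == k) p@_(mnm_of u) *: 'X_[mnm_of u].
Proof.
move=> hmf hk /dhomogP hp; apply/mpolyP => m; rewrite raddf_sum /=.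
under eq_bigr do rewrite mcoeffZ mcoeffX.
have [mp|mp] := boolP (m \in msupp p); last first.
  rewrite memN_msupp_eq0 // big1 // => u _; case: eqP => [e|];
    rewrite ?mulr0 // mulr1.
  by rewrite e memN_msupp_eq0.
have hm i : (m i < N)%N.
  apply: leq_ltn_trans hk; rewrite -(hp _ mp); apply: leq_trans (hmf _).
  by rewrite mdegE (bigD1 i) //= leq_addr.
pose u := [ffun i => Ordinal (hm i)].
have um : mnm_of u = m by apply/mnmP => i; rewrite mnmE ffunE.
rewrite (bigD1 u) /= um ?hp //= eqxx mulr1 big1 ?addr0 // => v /andP[_ vu].
by rewrite -um (inj_eq (@mnm_of_inj _)) (negPf vu) mulr0.
Qed.

Lemma monomial_frame : frame [set p : A | p \is d.-homog]
  (fun r : {ffun 'I_n.+1 -> 'I_N} => mdeg (mnm_of r) == d)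
  (fun r => 'X_[mnm_of r]) (fun r p => p@_(mnm_of r)).
Proof.
split=> [r /eqP hr|p hp|g r hr] /=.
- by rewrite dhomogX /= hr.
- exact: homog_expand.
- rewrite raddf_sum (bigD1 r) //= mcoeffZ mcoeffX eqxx mulr1 big1 ?addr0 // =>
  s /andP[_ sr].
  by rewrite mcoeffZ mcoeffX (inj_eq (@mnm_of_inj _)) (negPf sr) mulr0.
Qed.

Local Notation emon u := ('X_[mnm_of u] \mPo S).

(** Freeness over the symmetric polynomials gives the coordinate at [a]; the algebraic independence
    of the elementary symmetric polynomials, through [symf], expands it further. *)
Lemma artin_frame : frame [set p : A | p \is d.-homog]
  (fun x : I * {ffun 'I_n.+1 -> 'I_N} => mnmwgt (mnm_of x.2) + deg x.1 == d)%N
  (fun x => emon x.2 * mon x.1) (fun x p =>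
    (symf (acoord p x.1))@_(mnm_of x.2)).
Proof.
have big_pairs (F : I * {ffun 'I_n.+1 -> 'I_N} -> A) :
   \sum_(x | (mnmwgt (mnm_of x.2) + deg x.1 == d)%N) F x =
   \sum_a \sum_(u | (mnmwgt (mnm_of u) + deg a == d)%N) F (a, u).
  by rewrite pair_big_dep /=; apply: eq_bigr => -[].
split=> [[a u] /eqP /= <-|p hp|g [a u] /= hau] /=.
- by apply: dhomogM; [exact: dhomog_XS | exact: amon_homog].
- rewrite big_pairs {1}(acoordE p); apply: eq_bigr => a _ /=.
  have := acoord_homog a hp; case: ifP => [hd h|hd /eqP->]; last first.
    rewrite mul0r big_pred0 // => u; apply/negP => /eqP e.
    by rewrite -e leq_addl in hd.
  have hs : symf (acoord p a) \is (d - deg a).-homog for mnmwgt.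
    by rewrite mwmwgt_homogE -symfP ?acoord_sym.
  rewrite {1}(symfP (acoord_sym p a)) {1}(homog_expand (@leq_mdeg_mnmwgt _) _
    hs); last first.
    exact: leq_ltn_trans (leq_subr _ _) lt_dN.
  rewrite raddf_sum /= mulr_suml; apply: eq_big => [u|u _];
    last by rewrite comp_mpolyZ scalerAl.
  by rewrite -(eqn_add2r (deg a)) subnK.
- rewrite big_pairs; under eq_bigr do under eq_bigr do rewrite /= scalerAl.
  under eq_bigr do rewrite -mulr_suml.
  rewrite acoord_sum => [|b]; last first.
    by apply: rpred_sum => v _; apply: rpredZ; exact: esym_comp_sym.
  rewrite symf_sum => [|v]; last by apply: rpredZ; exact: esym_comp_sym.
  rewrite raddf_sum /= (bigD1 u) //= -comp_mpolyZ symf_comp mcoeffZ mcoeffX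
    eqxx mulr1.
  rewrite big1 ?addr0 // => v /andP[_ vu].
  by rewrite -comp_mpolyZ symf_comp mcoeffZ mcoeffX (inj_eq (@mnm_of_inj _))
    (negPf vu) mulr0.
Qed.

(** The trace of [w] in degree [d], computed twice. Monomials are permuted, so the fixed ones are
    counted; in the other basis [w] fixes the symmetric factor, which leaves [alpha]. *)
Lemma molien_coef :
  \sum_(r : {ffun 'I_n.+1 -> 'I_N} | mdeg (mnm_of r) == d) ([forall i, r (w i)
    == r i]%:R : rat) =
  \sum_(x : I * {ffun 'I_n.+1 ->
    'I_N} | (mnmwgt (mnm_of x.2) + deg x.1 == d)%N) alpha w x.1.
Proof.
have symsum (L : finType) (X : pred L) (g : L -> rat) (v : L -> A) :
    msym w (\sum_(i | X i) g i *: v i) = \sum_(i | X i) g i *: msym w (v i).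
  by rewrite raddf_sum; apply: eq_bigr => i _; rewrite /= msymZ.
have symW p : p \is d.-homog -> msym w p \is d.-homog.
  by rewrite !homog_piE -msym_pihomog => /eqP->.
have := frame_trace symsum symW monomial_frame artin_frame.
rewrite [X in X = _ -> _](eq_bigr (fun r : {ffun 'I_n.+1 ->
  'I_N} => [forall i, r (w i) == r i]%:R)).
  move=> ->; apply: eq_bigr => -[a u] /= /eqP hd.
  rewrite msymM (issymP _ (esym_comp_sym _)) acoordM ?esym_comp_sym //.
  have hs : msym w (mon a) \is (deg a).-homog.
    by have := @amon_homog rat n n.+1 a;
      rewrite !homog_piE -msym_pihomog => /eqP->.
  have := acoord_homog a hs; rewrite leqnn subnn => /homog0_const ->.
  by rewrite mulrC mul_mpolyC -comp_mpolyZ symf_comp mcoeffZ mcoeffX eqxx mulr1.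
move=> r _; rewrite msymX mcoeffX; congr (nat_of_bool _)%:R.
apply/eqP/forallP => [/mnmP e i|e].
  by have := e (w i); rewrite !mnmE permK => /val_inj ->.
by apply/mnmP => i; rewrite !mnmE -[in RHS](permKV w i) (eqP (e _)).
Qed.

End Molien.

Lemma eqp_low (p q : {poly rat}) : (forall N, 'X^N %| p - q) -> p = q.
Proof.
move=> h; apply/eqP; rewrite -subr_eq0; apply/negPn/negP => pq.
have := dvdp_leq pq (h (size (p - q))); by rewrite size_polyXn ltnn.
Qed.

Lemma dvdXnP N (p : {poly rat}) : (forall d, (d < N)%N -> p`_d = 0) ->
  'X^N %| p.
Proof.
move=> h; rewrite -(poly_take_drop N p) dvdp_addr ?dvdp_mulIr //.
suff -> : take_poly N p = 0 by exact: dvdp0.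
by apply/polyP => i; rewrite coef_take_poly coef0; case: ifP => // /h.
Qed.

Lemma geomX (c N : nat) :
  (1 - 'X^c) * (\sum_(k < N) 'X^(c * k)) = 1 - 'X^(c * N) :> {poly rat}.
Proof.
have -> : \sum_(k < N) 'X^(c * k) = \sum_(k < N) ('X^c) ^+ k :> {poly rat}.
  by apply: eq_bigr => k _; rewrite exprM.
rewrite exprM -[RHS]opprB subrX1 -mulNr opprB //.
Qed.

Lemma dvdXn_prod (T : finType) (P : pred T) (c : T -> nat) N :
  (forall i, P i -> 0 < c i)%N ->
  'X^N %| \prod_(i | P i) (1 - 'X^(c i * N)) - (1 : {poly rat}).
Proof.
move=> hc; elim/big_rec: _ => [|i p Pi hp]; first by rewrite subrr dvdp0.
rewrite mulrBl mul1r addrAC dvdp_sub //; apply: dvdp_mulr.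
by apply: dvdp_exp2l; rewrite leq_pmull // hc.
Qed.

Theorem chip_molien w :
  chip w * \prod_(c in porbits w) (1 - 'X^#|c|) =
    \prod_(i < n.+1) (1 - 'X^(i.+1)).
Proof.
apply: eqp_low => N.
(* [MP] and [PP] truncate the generating series of the monomials fixed by [w] and of the monomials
   in the elementary symmetric polynomials. A fixed monomial has exponents constant on cycles, so
   [sum_equivariant] with the identity factors [MP] into geometric sums. *)
pose MP : {poly rat} := \sum_(r : {ffun 'I_n.+1 ->
  'I_N} | [forall i, r (w i) == id (r i)]) \prod_i 'X^(r i).
pose PP : {poly rat} := \sum_(u : {ffun 'I_n.+1 ->
  'I_N}) \prod_(i < n.+1) 'X^(i.+1 * u i).
have MPE : MP = \prod_(c in porbits w) \sum_(k < N) 'X^(#|c| * k).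
  rewrite /MP (sum_equivariant w id (fun k : 'I_N => 'X^k : {poly rat})).
  apply: eq_bigr => c _; apply: eq_big => [k|k _].
    by apply/eqP; elim: #|_|.
  rewrite mulnC exprM -[X in _ ^+ X](card_ord #|c|) -prodr_const;
    apply: eq_bigr => l _.
  by congr ('X^_); elim: (l : nat).
have PPE : PP = \prod_(i < n.+1) \sum_(k < N) 'X^(i.+1 * k).
  by rewrite /PP bigA_distr_bigA.
have MPP : 'X^N %| MP - PP * chip w.
  apply: dvdXnP => d hd; apply/eqP; rewrite coefB subr_eq0; apply/eqP.
  transitivity (\sum_(r : {ffun 'I_n.+1 ->
    'I_N} | mdeg (mnm_of r) == d) ([forall i, r (w i) == r i]%:R : rat)).
    rewrite /MP coef_sum big_mkcond [RHS]big_mkcond; apply: eq_bigr => r _.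
    rewrite prodrXr coefXn mdeg_mnm_of eq_sym.
    by case: ifP; case: eqP.
  rewrite (molien_coef w hd) mulr_sumr coef_sum big_mkcond.
  rewrite -(pair_big xpredT xpredT (fun a u =>
    if (mnmwgt (@mnm_of N u) + deg a == d)%N then alpha w a else 0)) /=.
  apply: eq_bigr => a _; rewrite mulr_suml coef_sum; apply: eq_bigr => u _.
  rewrite prodrXr -scalerAr -exprD coefZ coefXn mnmwgt_mnm_of eq_sym.
  under [X in (_ == X + _)%N]eq_bigr do rewrite mulnC.
  by case: eqP; rewrite ?mulr1 ?mulr0.
set Dw := \prod_(c in _) _; set D := \prod_(i < n.+1) _.
have h1 : 'X^N %| Dw * MP - 1.
  rewrite MPE -big_split /=; under eq_bigr do rewrite geomX.
  apply: dvdXn_prod => c /imsetP[x _ ->]; by rewrite lt0n card_porbit_neq0.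
have h2 : 'X^N %| D * PP - 1.
  by rewrite PPE -big_split /=; under eq_bigr do rewrite geomX;
    exact: dvdXn_prod.
have -> : chip w * Dw - D = D * (Dw * MP - 1) - Dw * chip w * (D * PP - 1) - D
  * Dw * (MP - PP * chip w).
  ring.
by rewrite !dvdp_sub ?dvdp_mull.
Qed.

End CoinvariantTrace.

(** * The recursion for the polynomials H_n *)

Section CycleProducts.
Local Open Scope ring_scope.

Lemma prod_porbitsJ (R : comNzRingType) n (s t : 'S_n) (g : nat -> R) :
  \prod_(c in porbits (s ^ t)%g) g #|c| = \prod_(c in porbits s) g #|c|.
Proof.
rewrite !(prod_porbits _ _ (leqnn n)); apply: eq_bigr => j _.
by rewrite num_cyclesJ.
Qed.

Lemma prod_porbits_add_cycle (R : comNzRingType) m j (s : 'S_m) (g : nat ->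
  R) : (0 < j)%N ->
  \prod_(c in porbits (add_cycle j s)) g #|c| =
    g j * \prod_(c in porbits s) g #|c|.
Proof.
move=> j0; rewrite (prod_porbits _ _ (leqnn _)) (prod_porbits _ _ (leq_addr j
  m)).
have hj : (j < (m + j).+1)%N by rewrite ltnS leq_addl.
rewrite (eq_bigr (fun l : 'I_(m + j).+1 =>
  (if l == Ordinal hj then g j else 1) * g l ^+ num_cycles l s)).
  by rewrite big_split /= -big_mkcond big_pred1_eq.
move=> l _; rewrite num_cycles_add_cycle // exprD mulrC -val_eqE /=.
by case: eqP => [->|_]; rewrite ?expr1 ?expr0.
Qed.

Definition cycle_weight n (w : 'S_n) : {poly rat} :=
  \prod_(c in porbits w) (1 - 'X^#|c|).

Lemma one_subXn_neq0 (c : nat) : (0 < c)%N -> 1 - 'X^c != 0 :> {poly rat}.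
Proof.
by move=> c0; rewrite -opprB oppr_eq0 -size_poly_gt0 size_XnsubC.
Qed.

Lemma cycle_weight_neq0 n (w : 'S_n) : cycle_weight w != 0.
Proof.
apply/prodf_neq0 => c /imsetP[x _ ->]; apply: one_subXn_neq0.
by rewrite lt0n card_porbit_neq0.
Qed.

(** Molien's formula expresses [chip] through the cycle type, once the nonzero [cycle_weight] is
    cancelled. *)
Lemma chipJ n (w t : 'S_n.+1) : chip (w ^ t)%g = chip w.
Proof.
apply: (mulIf (cycle_weight_neq0 w));
  rewrite [RHS]chip_molien -[RHS](chip_molien (w ^ t)%g).
by congr (_ * _); rewrite /cycle_weight (prod_porbitsJ _ _ (fun c => 1 - 'X^c)).
Qed.

(** The ratio of the Molien numerators for [m.+1 + j] and [m.+1] variables, whence exponents from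
    m+2 to m+1+j. *)
Definition tail_factor m j : {poly rat} :=
  \prod_(i < j) (1 - 'X^((m.+1 + i).+1)).

Lemma chip_add_cycle m j (s : 'S_m.+1) : (0 < j)%N ->
  (1 - 'X^j) * @chip (m + j) (add_cycle j s) = tail_factor m j * chip s.
Proof.
move=> j0; apply: (mulIf (cycle_weight_neq0 s)).
rewrite -[RHS]mulrA [X in _ = _ * X]chip_molien.
rewrite [(1 - _) * _]mulrC -[LHS]mulrA.
rewrite -(prod_porbits_add_cycle s (fun c => 1 - 'X^c : {poly rat}) j0).
by rewrite [LHS](@chip_molien (m + j)) -[(m + j).+1]/(m.+1 + j)%N big_split_ord
  mulrC.
Qed.

(* Unlike the monomials in the [X_j], these products are stable under the shift
   [X_j |-> X_j + 1]. *)
Definition cyc_prod (s : seq (nat * rat)) n (w : 'S_n) : rat :=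
  \prod_(x <- s) ((num_cycles x.1 w)%:R + x.2).

Definition cyc_shift j (s : seq (nat * rat)) :=
  [seq (x.1, (x.1 == j)%:R + x.2) | x <- s].

(** This is H_(n+1): the index is one below the size, as the Artin basis is built for [n.+1]
    variables. *)
Definition hilb (f : forall n, 'S_n -> rat) n : {poly rat} :=
  ((n.+1)`!%:R^-1) *: \sum_(w : 'S_n.+1) f n.+1 w *: chip w.

Lemma hilb_nil n : hilb (cyc_prod [::]) n = 1.
Proof.
rewrite /hilb (eq_bigr (fun w : 'S_n.+1 => chip w)) => [|w _].
  rewrite sum_chip -[_%:R in X in _ *: X]mulr1 -[X in _ *: (X * 1)]polyC_natr
    mul_polyC scalerA.
  by rewrite mulVf ?scale1r // pnatr_eq0 -lt0n fact_gt0.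
by rewrite /cyc_prod big_nil scale1r.
Qed.

Definition mark j (f : forall n, 'S_n -> rat) n (w : 'S_n) : rat :=
  (num_cycles j w)%:R * f n w.

Lemma hilb_cons x s n :
  hilb (cyc_prod (x :: s)) n = hilb (mark x.1 (cyc_prod s)) n + x.2 *: hilb
    (cyc_prod s) n.
Proof.
rewrite /hilb [x.2 *: _]scalerA [x.2 * _]mulrC -scalerA -scalerDr [x.2 *:
  _]scaler_sumr.
rewrite -big_split /=; congr (_ *: _).
by apply: eq_bigr => w _; rewrite scalerA -scalerDl /mark /cyc_prod big_cons
  mulrDl.
Qed.

Lemma hilb_mark j s m : (0 < j)%N ->
  (1 - 'X^j) * hilb (mark j (cyc_prod s)) (m + j) =
  j%:R^-1 *: (tail_factor m j * hilb (cyc_prod (cyc_shift j s)) m).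
Proof.
move=> j0.
pose g (w : 'S_(m.+1 + j)) : {poly rat} := cyc_prod s w *: @chip (m + j) w.
have gJ w t : g (w ^ t)%g = g w.
  rewrite /g (@chipJ (m + j)) /cyc_prod; congr (_ *: _).
  by apply: eq_bigr => x _; rewrite num_cyclesJ.
have f0 k : (k`!)%:R != 0 :> rat by rewrite pnatr_eq0 -lt0n fact_gt0.
have jn0 : j%:R != 0 :> rat by rewrite pnatr_eq0 -lt0n.
have := sum_num_cycles j0 gJ.
rewrite (eq_bigr (fun w : 'S_(m.+1 + j) =>
  (j%:R * (m.+1)`!%:R) *: (mark j (cyc_prod s) w *: @chip (m + j) w)));
  last first.
  move=> w _; rewrite /g /mark scalerA -scalerAr -mulr_natl.
  rewrite -[(_ * _)%:R]polyC_natr mulr1 mul_polyC !scalerA; congr (_ *: _).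
  by rewrite !natrM; ring.
rewrite -scaler_sumr => E.
have {}E : \sum_(w : 'S_(m.+1 + j)) mark j (cyc_prod s) w *: @chip (m + j) w =
  (j%:R * (m.+1)`!%:R)^-1 *: ((m.+1 + j)`!%:R * \sum_(s : 'S_m.+1) g (add_cycle
    j s)).
  by rewrite -E scalerA mulVf ?scale1r // mulf_neq0.
rewrite /hilb [X in _ * (_ *: X)]E -[(m.+1 + j)`!%:R in X in _ * (_ *: (_ *: (X
  * _)))]polyC_natr mul_polyC.
rewrite !scalerA -[(m + j).+1]/(m.+1 + j)%N -scalerAr mulr_sumr.
rewrite -scalerAr scalerA mulr_sumr; congr (_ *: _).
  by rewrite invfM; field; rewrite jn0 !f0.
apply: eq_bigr => w _; rewrite /g -!scalerAr chip_add_cycle //; congr (_ *: _).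
rewrite /cyc_prod big_map; apply: eq_bigr => x _ /=.
by rewrite num_cycles_add_cycle // natrD addrA.
Qed.

End CycleProducts.

(** * Stabilisation and limits *)

Section StableSequences.
Import Order.TTheory pseudometric_normed_Zmodule normed_module.
Local Open Scope classical_set_scope.
Local Open Scope ring_scope.

Variables (R : realType) (x : R).
Hypotheses (x_ge0 : 0 <= x) (x_lt1 : x < 1).

(** The distance to [l / (1 - c)] shrinks by the factor [c] every [j] steps, up to the error of [v].
    The residue classes modulo [j] evolve independently, and [B] dominates the initial distance of
    each. *)
Lemma lin_rec_cvg (u v : nat -> R) (c l : R) (j : nat) : (0 < j)%N ->
  0 <= c -> c < 1 ->
  (forall N, u (N + j)%N = v N + c * u N) -> v @ \oo --> l ->
    u @ \oo --> l / (1 - c).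
Proof.
move=> j0 c0 c1 uE vl.
have c1' : 0 < 1 - c by lra.
pose d N := `|u N - l / (1 - c)|.
have dE N : d (N + j)%N <= `|v N - l| + c * d N.
  rewrite /d uE.
  have -> : v N + c * u N - l / (1 - c) = (v N - l) + c * (u N - l / (1 - c)).
    by field; lra.
  by rewrite (le_trans (ler_normD _ _)) // normrM (ger0_norm c0).
apply/cvgrPdist_lt => e e0.
(* Errors of this size, damped by [c] at each step, accumulate to at most [e / 2]. *)
have e2 : 0 < e / 2 * (1 - c) by rewrite mulr_gt0 ?divr_gt0.
have [N0 _ hN0] : \forall N \near \oo, `|v N - l| < e / 2 * (1 - c).
  by move/cvgrPdist_lt: vl => /(_ _ e2); apply: filterS => N; rewrite distrC.
pose B := \sum_(i < j) d (N0 + i)%N.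
have B0 : 0 <= B by apply: sumr_ge0 => i _; exact: normr_ge0.
have dB k i : (i < j)%N -> d (N0 + i + k * j)%N <= e / 2 + c ^+ k * B.
  move=> ij; elim: k => [|k IH].
    rewrite mul0n addn0 expr0 mul1r /B (bigD1 (Ordinal ij)) //= addrCA ler_wpDr
      //.
    by apply: addr_ge0; [lra | apply: sumr_ge0 => l' _; exact: normr_ge0].
  rewrite mulSn addnCA addnC; apply: le_trans (dE _) _.
  have h1 : `|v (N0 + i + k * j)%N - l| < e / 2 * (1 - c).
    by apply: hN0; rewrite /= -addnA leq_addr.
  have h2 : c * d (N0 + i + k * j)%N <= c * (e / 2 + c ^+ k * B) by rewrite
    ler_wpM2l.
  rewrite exprS; move: h1 h2; set D := d _; set E := c ^+ k; set W := `|_|; nra.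
have ck : (fun k => c ^+ k * B) @ \oo --> (0 : R).
  rewrite -(mul0r B); apply: cvgMl; apply: cvg_expr.
  by rewrite ger0_norm.
have e3 : 0 < e / 2 by rewrite divr_gt0.
have [K _ hK] : \forall k \near \oo, c ^+ k * B < e / 2.
  move/cvgrPdist_lt: ck => /(_ _ e3); apply: filterS => k.
  by rewrite sub0r normrN ger0_norm // mulr_ge0 // exprn_ge0.
exists (N0 + K * j)%N => // N /= hN.
have -> : `|l / (1 - c) - u N| = d N by rewrite distrC.
have NE : N = (N0 + (N - N0) %% j + (N - N0) %/ j * j)%N.
  have := divn_eq (N - N0) j; move: (leq_trans (leq_addr (K * j) N0) hN); lia.
have hk : (K <= (N - N0) %/ j)%N by rewrite leq_divRL // leq_subRL //
  (leq_trans (leq_addr (K * j) N0) hN).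
rewrite NE; apply: le_lt_trans (dB _ _ _) _; first by rewrite ltn_mod.
by have := hK _ hk; lra.
Qed.

Definition evx (p : {poly rat}) : R := (map_poly ratr p).[x].

Lemma evxD p q : evx (p + q) = evx p + evx q.
Proof. by rewrite /evx rmorphD hornerD. Qed.

Lemma evxM p q : evx (p * q) = evx p * evx q.
Proof. by rewrite /evx rmorphM hornerM. Qed.

Lemma evxZ c p : evx (c *: p) = ratr c * evx p.
Proof. by rewrite /evx -mul_polyC rmorphM /= map_polyC /= hornerM hornerC. Qed.

Lemma evx1 : evx 1 = 1.
Proof. by rewrite /evx rmorph1 hornerC. Qed.

Lemma evx_1BXn k : evx (1 - 'X^k) = 1 - x ^+ k.
Proof. by rewrite /evx rmorphB /= rmorph1 map_polyXn !hornerE. Qed.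

Lemma evx_prod (I : finType) (P : pred I) (F : I -> {poly rat}) :
  evx (\prod_(i | P i) F i) = \prod_(i | P i) evx (F i).
Proof. by elim/big_rec2: _ => [|i p q _ <-]; rewrite ?evx1 ?evxM. Qed.

(** The invariant of the induction on character polynomials; the common [L] of the last two clauses
    is what finally equates the two limits. *)
Definition stable_seq (F : nat -> {poly rat}) (f : nat -> rat) (L : R) :=
  [/\ forall i, exists N, forall n, (N <= n)%N -> (F n)`_i = f i,
      series (fun i => ratr (f i) * x ^+ i) @ \oo --> L
    & (fun n => evx (F n)) @ \oo --> L].

Lemma stable_seq1 : stable_seq (fun=> 1) (fun i => (i == 0)%:R) 1.
Proof.
split=> [i||]; first by exists 0%N => n _; rewrite coef1.
- apply: cvg_near_cst; near=> n; rewrite /series /=.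
  rewrite -[n]prednK; last by near: n; exists 1%N.
  rewrite big_nat_recl //= big1 ?addr0 ?expr0 ?mulr1 ?ratr_nat // => i _.
  by rewrite /= ?rmorph0 mul0r.
- by under eq_fun do rewrite evx1; exact: cvg_cst.
Unshelve. all: by end_near. Qed.

Lemma stable_seq_lin F G f g L M (c : rat) :
  stable_seq F f L -> stable_seq G g M ->
  stable_seq (fun n => F n + c *: G n) (fun i =>
    f i + c * g i) (L + ratr c * M).
Proof.
move=> [hF sF vF] [hG sG vG]; split=> [i||].
- have [N1 h1] := hF i; have [N2 h2] := hG i; exists (maxn N1 N2) => n.
  by rewrite geq_max => /andP[n1 n2]; rewrite coefD coefZ h1 ?h2.
- rewrite (_ : series _ = (fun n => series (fun i => ratr (f i) * x ^+ i) n +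
     ratr c * series (fun i => ratr (g i) * x ^+ i) n)); last first.
    apply/funext => n; rewrite /series /= mulr_sumr -big_split /=;
      apply: eq_bigr => i _.
    by rewrite rmorphD rmorphM mulrDl mulrA.
  by apply: cvgD => //; apply: cvgMr.
- under eq_fun do rewrite evxD evxZ.
  by apply: cvgD => //; apply: cvgMr.
Qed.

(** All exponents in the factors exceed [m], so coefficients up to [m] are untouched. *)
Lemma tail_factor_coef m j (p : {poly rat}) i : (i <= m)%N ->
  (tail_factor m j * p)`_i = p`_i.
Proof.
move=> im; rewrite /tail_factor; elim/big_rec: _ => [|k q _ IH];
  first by rewrite mul1r.
rewrite mulrBl mul1r mulrBl coefB -mulrA coefXnM IH ifT ?subr0 //.
by move: im; lia.
Qed.

Lemma tail_factor_cvg j : (fun m => evx (tail_factor m j)) @ \oo --> (1 : R).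
Proof.
rewrite /tail_factor.
elim: j => [|j IH].
  by under eq_fun do rewrite big_ord0 evx1; exact: cvg_cst.
under eq_fun do rewrite big_ord_recr /= evxM evx_1BXn.
have pw : (fun n => 1 - x ^+ (n.+1 + j).+1) @ \oo --> (1 - 0 : R).
  apply: cvgB; first exact: cvg_cst.
  rewrite (_ : (fun n => _) = (fun n => x ^+ (n + j.+2))); last first.
    by apply/funext => n; congr (_ ^+ _); lia.
  by rewrite (cvg_shiftn j.+2 (fun n => x ^+ n)); apply: cvg_expr;
    rewrite ger0_norm.
by have h := cvgM IH pw; rewrite subr0 mulr1 in h; exact: h.
Qed.

(** Coefficient [i] of [G] is that of index [i - j] plus a multiple of coefficient [i] of [F], so
    stabilisation follows by strong induction. Summed up, this is the recursion of [lin_rec_cvg]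
    with ratio [x ^+ j]; the values at [x] follow on dividing by [1 - x ^+ j]. *)
Lemma stable_seq_step (F G : nat -> {poly rat}) f L j : (0 < j)%N ->
  (forall m, (1 - 'X^j) * G (m + j)%N = j%:R^-1 *: (tail_factor m j * F m)) ->
  stable_seq F f L -> exists g M, stable_seq G g M.
Proof.
move=> j0 GF [hF sF vF].
have coefG m i : (i <= m)%N ->
    (G (m + j)%N)`_i = (if (i < j)%N then 0 else (G (m + j)%N)`_(i - j)) +
      j%:R^-1 * (F m)`_i.
  move=> im; have := congr1 (fun p : {poly rat} => p`_i) (GF m).
  rewrite mulrBl mul1r coefB coefXnM coefZ tail_factor_coef // => /eqP.
  by rewrite subr_eq addrC => /eqP.
have stab i : exists gi N, forall n, (N <= n)%N -> (G n)`_i = gi.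
  have [k] := ubnP i; elim: k i => // k IH i; rewrite ltnS => ik.
  have [N1 h1] := hF i.
  have [gi [N2 h2]] : exists gi N, forall n, (N <= n)%N ->
    (if (i < j)%N then 0 else (G n)`_(i - j)) = gi.
    case: (ssrnat.ltnP i j) => ij; first by exists 0, 0%N.
    by apply: IH; move: ij ik j0; lia.
  exists (gi + j%:R^-1 * f i), (maxn i (maxn N1 N2) + j)%N => n hn.
  have nE : n = (n - j + j)%N by rewrite subnK // (leq_trans (leq_addl _ _) hn).
  rewrite nE coefG; last by move: hn; lia.
  by rewrite -nE h2 ?h1 //; move: hn; lia.
have [g hg] := choice stab.
have gE i : g i = (if (i < j)%N then 0 else g (i - j)%N) + j%:R^-1 * f i.
  have [N1 h1] := hF i; have [N2 h2] := hg i; have [N3 h3] := hg (i - j)%N.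
  pose m := (i + (N1 + (N2 + N3)))%N.
  rewrite -(h2 (m + j)%N); last by rewrite /m; lia.
  rewrite coefG; last by rewrite /m; lia.
  rewrite h1; last by rewrite /m; lia.
  by rewrite h3 //; rewrite /m; lia.
have xj0 : 0 <= x ^+ j by rewrite exprn_ge0.
have xj1 : x ^+ j < 1 by rewrite exprn_ilt1 // -lt0n.
have jR : ratr (j%:R^-1) = j%:R^-1 :> R by rewrite fmorphV rmorph_nat.
exists g, (j%:R^-1 * L / (1 - x ^+ j)); split=> //.
- apply: (@lin_rec_cvg _ (fun N => j%:R^-1 * series (fun i =>
  ratr (f i) * x ^+ i) (N + j)%N) _ _ j) => //.
    move=> N; rewrite /series /= mulr_sumr.
    have E K : \sum_(0 <= i < K) ratr (g i) * x ^+ i =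
       \sum_(0 <= i < K) j%:R^-1 * (ratr (f i) * x ^+ i) +
       \sum_(0 <= i < K) (if (i < j)%N then 0 else ratr (g (i - j)%N) * x ^+ i).
      rewrite -big_split /=; apply: eq_bigr => i _.
      by rewrite gE rmorphD rmorphM /= jR; case: ifP => _; rewrite ?rmorph0;
        ring.
    have jN : (j <= N + j)%N by rewrite leq_addl.
    suff -> : \sum_(0 <= i < N + j) ratr (g i) * x ^+ i =
       \sum_(0 <= i < N + j) j%:R^-1 * (ratr (f i) * x ^+ i) +
       x ^+ j * \sum_(0 <= i < N) ratr (g i) * x ^+ i by [].
    rewrite E; congr (_ + _); rewrite (big_cat_nat (leq0n j) jN) /=.
    rewrite [X in X + _]big1_seq ?add0r; last by move=> i;
      rewrite mem_index_iota => /= ->.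
    rewrite -{1}[j]add0n big_addn addnK mulr_sumr; apply: eq_bigr => i _.
    by rewrite ltnNge leq_addl /= addnK exprD; ring.
  apply: cvgMr; rewrite (cvg_shiftn j (series (fun i =>
    ratr (f i) * x ^+ i))) //.
- rewrite -(cvg_shiftn j).
  rewrite (_ : (fun n => _) = (fun m =>
    j%:R^-1 * (evx (tail_factor m j) * evx (F m)) / (1 - x ^+ j))).
    apply: cvgMl; apply: cvgMr; have h := cvgM (tail_factor_cvg j) vF.
    by rewrite mul1r in h; exact: h.
  apply/funext => m; have := congr1 evx (GF m).
  rewrite evxM evx_1BXn evxZ evxM jR => <-; field; lra.
Qed.

(** The induction is on the length, because marking a cycle leads to the shifted list
    [cyc_shift j s] rather than to the tail [s] itself. *)
Lemma stable_cyc_prod (s : seq (nat * rat)) :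
  exists f L, stable_seq (hilb (cyc_prod s)) f L.
Proof.
have [k] := ubnP (size s); elim: k s => // k IH [|[j e] s] hs.
  exists (fun i => (i == 0)%:R), 1; rewrite (_ : hilb _ = fun=> 1);
    first exact: stable_seq1.
  by apply/funext => n; rewrite hilb_nil.
have [f [L hf]] := IH s hs.
rewrite (_ : hilb _ = fun n =>
  hilb (mark j (cyc_prod s)) n + e *: hilb (cyc_prod s) n); last first.
  by apply/funext => n; rewrite hilb_cons.
suff [g [M hg]] : exists g M, stable_seq (hilb (mark j (cyc_prod s))) g M.
  by exists (fun i => g i + e * f i), (M + ratr e * L); exact: stable_seq_lin.
case: (posnP j) => [->|j0].
  (* A permutation has no cycle of length 0, so the marked sequence is zero; it is written as a
     difference to fall under [stable_seq_lin]. *)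
  exists (fun i => f i + (-1) * f i), (L + ratr (-1) * L).
  rewrite (_ : hilb _ = fun n =>
    hilb (cyc_prod s) n + (-1) *: hilb (cyc_prod s) n).
    exact: stable_seq_lin.
  apply/funext => n; rewrite scaleN1r subrr /hilb big1 ?scaler0 // => w _.
  by rewrite /mark num_cycles0 mul0r scale0r.
have hs' : (size (cyc_shift j s) < k)%N by rewrite size_map.
have [f' [L' hf']] := IH _ hs'.
by apply: (stable_seq_step j0 _ hf') => m; exact: hilb_mark.
Qed.

Lemma cyc_prod_charpol k (P : {mpoly rat[k]}) :
  exists (r : seq (rat * seq (nat * rat))), forall n (w : 'S_n),
    charpol_eval P w = \sum_(y <- r) y.1 * cyc_prod y.2 w.
Proof.
exists [seq (P@_m, flatten [seq nseq (m i) (i.+1, 0) | i : 'I_k]) | m <- msupp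
  P] => n w.
rewrite /charpol_eval mevalE [RHS]big_map; apply: eq_bigr => m _ /=;
  congr (_ * _).
rewrite /cyc_prod big_flatten /= big_map big_enum /=; apply: eq_bigr => i _.
by rewrite big_nseq addr0 iter_mulr_1.
Qed.

Lemma stable_charpol k (P : {mpoly rat[k]}) :
  exists f L, stable_seq (hilb (@charpol_eval k P)) f L.
Proof.
have [r hr] := cyc_prod_charpol P.
have -> : hilb (@charpol_eval k P) =
  hilb (fun n w => \sum_(y <- r) y.1 * cyc_prod y.2 w).
  by apply/funext => n; rewrite /hilb; congr (_ *: _); apply: eq_bigr => w _;
    rewrite hr.
elim: r {hr} => [|y r [f [L hf]]].
  exists (fun i => (i == 0)%:R + (-1) * (i == 0)%:R), (1 + ratr (-1) * 1).
  rewrite (_ : hilb _ = fun n => 1 + (-1) *: 1);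
    first by apply: stable_seq_lin; exact: stable_seq1.
  apply/funext => n; rewrite scaleN1r subrr /hilb big1 ?scaler0 // => w _.
  by rewrite big_nil scale0r.
have [g [M hg]] := stable_cyc_prod y.2.
exists (fun i => f i + y.1 * g i), (L + ratr y.1 * M).
rewrite (_ : hilb _ = fun n => hilb (fun n w =>
  \sum_(y <- r) y.1 * cyc_prod y.2 w) n + y.1 *: hilb (cyc_prod y.2) n).
  exact: stable_seq_lin.
apply/funext => n; rewrite /hilb [y.1 *: _]scalerA [y.1 * _]mulrC -scalerA
  -scalerDr; congr (_ *: _).
rewrite scaler_sumr -big_split /=; apply: eq_bigr => w _.
by rewrite big_cons scalerA -scalerDl addrC.
Qed.

End StableSequences.

(** * Frobenius on an algebraically closed field *)

Section Frobenius.
Local Open Scope ring_scope.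

Variables (F : finFieldType) (K : closedFieldType) (iota : {rmorphism F -> K}).
Local Notation q := #|F|.

Lemma pnat_card_field : [pchar K].-nat q.
Proof.
have [p p_pr pF] := finPcharP F.
have pK : p \in [pchar K] by rewrite (fmorph_pchar iota).
have := abelem_pgroup (fin_ring_pchar_abelem pF).
by rewrite /pgroup cardsT; apply: sub_in_pnat => r _; rewrite inE => /eqP->.
Qed.

(** The argument [iota] ties the power map to its ring morphism structure: additivity rests on [K]
    having, through [iota], the characteristic of [F]. *)
Definition frobq of {rmorphism F -> K} := fun x : K => x ^+ q.
Local Notation phi := (frobq iota).

Lemma frobq_zmod : zmod_morphism phi.
Proof.
have q0 : (0 < q)%N by apply/card_gt0P; exists 0.
move=> x y; rewrite /frobq exprDn_pchar ?pnat_card_field //; congr (_ + _).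
apply/eqP; rewrite -addr_eq0 addrC -exprDn_pchar ?pnat_card_field //.
by rewrite subrr expr0n gtn_eqF.
Qed.

Lemma frobq_monoid : monoid_morphism phi.
Proof. by split=> [|x y]; rewrite /frobq ?expr1n ?exprMn. Qed.

HB.instance Definition _ := GRing.isZmodMorphism.Build K K phi frobq_zmod.
HB.instance Definition _ := GRing.isMonoidMorphism.Build K K phi frobq_monoid.

Lemma iter_frobq l x : iter l phi x = x ^+ (q ^ l).
Proof. by elim: l => [|l IH] /=; rewrite ?expr1 // IH /frobq -exprM expnSr. Qed.

Lemma frobq_iota a : phi (iota a) = iota a.
Proof. by rewrite /frobq -rmorphXn expf_card. Qed.

Lemma card_field_gt1 : (1 < q)%N.
Proof. exact: finNzRing_gt1. Qed.

Definition fix_poly l : {poly K} := 'X^(q ^ l) - 'X.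

Lemma fix_poly_root l x : root (fix_poly l) x = (iter l phi x == x).
Proof. by rewrite /root /fix_poly !hornerE subr_eq0 iter_frobq. Qed.

Lemma ltn_1_qX l : (0 < l)%N -> (1 < q ^ l)%N.
Proof. by case: l => // l _; rewrite -(exp1n l.+1) ltn_exp2r ?card_field_gt1.
  Qed.

Lemma size_fix_poly l : (0 < l)%N -> size (fix_poly l) = (q ^ l).+1.
Proof.
move=> l0; rewrite /fix_poly size_polyDl size_polyXn // size_polyN size_polyX
  ltnS.
exact: ltn_1_qX.
Qed.

(** The derivative of [fix_poly l] is -1, as q vanishes in [K]; hence its roots in the closed field
    are simple. *)
Lemma fix_seq_exists l : (0 < l)%N ->
  exists r : seq K, [/\ uniq r, size r = (q ^ l)%N & forall x, (x \in r) =
    (iter l phi x == x)].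
Proof.
move=> l0; have [r rE] := closed_field_poly_normal (fix_poly l).
have lc : lead_coef (fix_poly l) = 1.
  by rewrite lead_coefDl ?lead_coefXn // size_polyN size_polyX size_polyXn ltnS
    ltn_1_qX.
rewrite lc scale1r in rE.
exists r; split.
- rewrite -separable_prod_XsubC -rE unlock derivB derivXn derivX.
  have -> : 'X^((q ^ l).-1) *+ (q ^ l) = 0 :> {poly K}.
    rewrite -mulr_natr -polyC_natr.
    suff -> : (q ^ l)%:R = 0 :> K by rewrite mulr0.
    have [p p_pr pF] := finPcharP F.
    have pK : p \in [pchar K] by rewrite (fmorph_pchar iota).
    have q0 : q%:R = 0 :> K.
      rewrite -(rmorph_nat iota); have :=
        abelem_pgroup (fin_ring_pchar_abelem pF).
      rewrite /pgroup cardsT => /p_natP[e qE].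
      have e0 : (0 < e)%N by case: e qE => // qE; have := card_field_gt1;
        rewrite qE.
      by rewrite qE natrX (pcharf0 pF) expr0n gtn_eqF ?rmorph0.
    by rewrite natrX q0 expr0n gtn_eqF.
  by rewrite sub0r -scaleN1r coprimepZr ?oppr_eq0 ?oner_eq0 // coprimep1.
- by have := size_fix_poly l0; rewrite rE size_prod_XsubC => -[].
- by move=> x; rewrite -fix_poly_root rE root_prod_XsubC.
Qed.

Lemma frobq_fixP x : phi x = x -> exists a, x = iota a.
Proof.
move=> hx; have [r [ur sr rP]] := @fix_seq_exists 1 isT.
pose s := [seq iota a | a <- enum F].
have us : uniq s by rewrite map_inj_uniq ?enum_uniq //; exact: fmorph_inj.
have ss : {subset s <= r} by move=> y /mapP[a _ ->]; rewrite rP /= frobq_iota.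
have := uniq_min_size us ss; rewrite sr expn1 size_map -cardE leqnn =>
  /(_ isT)[_ e].
have : x \in s by rewrite e rP /= hx.
by move=> /mapP[a _ ->]; exists a.
Qed.

Lemma frobq_root x : {y | phi y = x}.
Proof.
have q1 := card_field_gt1.
have q0 : (0 < q)%N := ltnW q1.
have : exists y, root ('X^q - x%:P) y.
  by apply/closed_rootP; rewrite size_XnsubC // gtn_eqF.
move=> /sigW[y]; rewrite /root !hornerE subr_eq0 => /eqP.
by exists y.
Qed.

(** An equation of Artin-Schreier type, solvable in a closed field; it supplies the correction in
    [frob_stable_defined]. *)
Lemma frobq_sub_root c : exists x, phi x - x = c.
Proof.
have q1 := card_field_gt1.
have : exists y, root (fix_poly 1 - c%:P) y.
  apply/closed_rootP; rewrite size_polyDl ?size_fix_poly //; last first.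
    by rewrite size_polyN size_polyC ltnS expn1;
      apply: leq_trans (leq_b1 _) (ltnW q1).
  by rewrite expn1 eqSS -lt0n (ltnW q1).
move=> [y]; rewrite /root /fix_poly !hornerE expn1 subr_eq0 => /eqP.
by exists y.
Qed.

(** Taken among the q^(m+1) fixed points of an iterate of Frobenius; they provide diagonal matrices
    with distinct eigenvalues. *)
Lemma distinct_units m : exists d : 'I_m ->
  K, injective d /\ forall i, d i != 0.
Proof.
have [r [ur sr rP]] := @fix_seq_exists m.+1 isT.
have hs : (m < size r)%N by rewrite sr (ltn_trans (ltnSn m)) // ltn_expl //
  card_field_gt1.
pose r' := rem 0 r.
have r'0 : 0 \notin r' by rewrite mem_rem_uniq // inE eqxx.
have ur' : uniq r' by rewrite rem_uniq.
have hs' : (m <= size r')%N.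
  by rewrite size_rem ?rP; [move: hs; case: (size r) | apply/eqP;
    elim: (m.+1) => //= k ->; exact: rmorph0].
have hi (i : 'I_m) : (i < size r')%N := leq_trans (ltn_ord i) hs'.
exists (fun i => nth 0 r' i); split=> [i j /eqP|i].
  by rewrite nth_uniq // => /eqP/val_inj.
by apply: contraNneq r'0 => <-; exact: mem_nth.
Qed.

End Frobenius.

(** * Maximal tori as diagonal tori *)

Section DiagonalTori.
Local Open Scope classical_set_scope.
Local Open Scope ring_scope.

Variables (F : finFieldType) (K : closedFieldType) (iota : {rmorphism F -> K}).
Variable n : nat.
Local Notation phi := (frobq iota).
Local Notation frobM := (map_mx phi).
Implicit Types (A B Q : 'M[K]_n) (T : set 'M[K]_n) (d : 'rV[K]_n).

Definition dtorus Q : set 'M[K]_n := [set A | A \in unitmx /\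
  forall j, exists a, forall i, (A *m Q) i j = a * Q i j].

Definition same_lines Q1 Q2 := exists (w : 'S_n) (e : 'I_n -> K),
  (forall j, e j != 0) /\ forall i j, Q1 i j = Q2 i (w j) * e j.

Lemma same_lines_dtorus Q1 Q2 : same_lines Q1 Q2 -> dtorus Q1 = dtorus Q2.
Proof.
move=> [w [e [e0 E]]].
have AE A i j : (A *m Q1) i j = (A *m Q2) i (w j) * e j.
  by rewrite !mxE mulr_suml; apply: eq_bigr => k _; rewrite E mulrA.
apply/seteqP; split=> A [uA hA]; split=> // j.
  have [a ha] := hA (w^-1%g j); exists a => i; have := ha i.
  rewrite AE E permKV mulrA => /mulIf; apply; exact: e0.
by have [a ha] := hA (w j); exists a => i; rewrite AE ha E mulrA.
Qed.

Lemma col_neq0 Q j : Q \in unitmx -> exists i, Q i j != 0.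
Proof.
move=> uQ; apply/existsP; apply: contraTT uQ; rewrite negb_exists => /forallP h.
rewrite unitmxE unitfE negbK (expand_det_col _ j) big1 // => i _.
by have := h i; rewrite negbK => /eqP->; rewrite mul0r.
Qed.

Definition conj_diag Q (d : 'rV[K]_n) : 'M[K]_n := Q *m diag_mx d *m invmx Q.

Lemma conj_diag_mul Q d : Q \in unitmx ->
  forall i j, (conj_diag Q d *m Q) i j = d 0 j * Q i j.
Proof.
by move=> uQ i j; rewrite /conj_diag mulmxKV // mul_mx_diag mxE mulrC.
Qed.

Lemma conj_diag_dtorus Q d : Q \in unitmx -> (forall j, d 0 j != 0) ->
  dtorus Q (conj_diag Q d).
Proof.
move=> uQ d0; split; last by move=> j; exists (d 0 j) => i;
  exact: conj_diag_mul.
rewrite !unitmx_mul uQ unitmx_inv uQ andbT /= unitmxE det_diag unitfE.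
by apply/prodf_neq0 => j _.
Qed.

Lemma regular_exists : exists d : 'rV[K]_n, injective (d 0) /\ forall j, d 0 j
  != 0.
Proof.
have [d [dI d0]] := distinct_units iota n.
by exists (\row_j d j); split=> [i j|j]; rewrite !mxE //; exact: dI.
Qed.

(** A regular element of the first torus lies in the second, so the change of frame [N] intertwines
    two diagonal matrices, the first with distinct entries. This forces [N] to be monomial. *)
Lemma dtorus_sub Q1 Q2 : Q1 \in unitmx -> Q2 \in unitmx ->
  dtorus Q1 `<=` dtorus Q2 -> same_lines Q1 Q2.
Proof.
move=> u1 u2 sub; have [d [dI d0]] := regular_exists.
have [uA hA] := sub _ (conj_diag_dtorus u1 d0).
set A := conj_diag Q1 d in uA hA.
pose N := invmx Q2 *m Q1.
have uN : N \in unitmx by rewrite unitmx_mul unitmx_inv u2 u1.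
have Q1E : Q1 = Q2 *m N by rewrite /N mulKVmx.
have hN i j : N i j != 0 -> forall a, (forall k, (A *m Q2) k i =
  a * Q2 k i) -> d 0 j = a.
  move=> Nij a ha; apply: (mulIf Nij).
  pose D : 'rV[K]_n := \row_k sval (cid (hA k)).
  have AQ : A *m Q2 = Q2 *m diag_mx D.
    apply/matrixP => k l; rewrite mul_mx_diag mxE [in RHS]mxE mulrC.
    by case: cid => b hb /=; rewrite hb.
  have Da : D 0 i = a.
    have [k hk] := col_neq0 i u2; apply: (mulIf hk);
      rewrite -ha AQ mul_mx_diag mxE mulrC //.
  have ND : N *m diag_mx d = diag_mx D *m N.
    apply: (can_inj (mulKmx u2)); rewrite !mulmxA -AQ mulmxV // mul1mx mulmxK
      //.
    by apply/matrixP => k l; rewrite conj_diag_mul // mul_mx_diag mxE mulrC.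
  have := congr1 (fun M : 'M[K]_n => M i j) ND.
  by rewrite mul_mx_diag mul_diag_mx [LHS]mxE [RHS]mxE Da mulrC.
have uniqN i j j' : N i j != 0 -> N i j' != 0 -> j = j'.
  move=> h h'; apply: dI; have [a ha] := hA i.
  by rewrite (hN _ _ h a ha) (hN _ _ h' a ha).
(* Each row of [N] has at most one nonzero entry and each column at least one; [wf] is the resulting
   permutation. *)
pose wf j := sval (cid (col_neq0 j uN)).
have wfP j : N (wf j) j != 0 by rewrite /wf; case: cid.
have wI : injective wf by move=> j j' e; apply: (uniqN (wf j));
  rewrite ?wfP // e wfP.
exists (perm wI), (fun j => N (wf j) j); split=> [j|i j]; first exact: wfP.
rewrite {1}Q1E mxE (bigD1 (wf j)) //= permE big1 ?addr0 // => k kj.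
have [->|Nkj] := eqVneq (N k j) 0; first by rewrite mulr0.
pose j' := (perm wI)^-1%g k.
have kE : k = wf j' by rewrite -[wf j'](permE wI) permKV.
move: kj Nkj; rewrite kE => kj Nkj.
by rewrite (uniqN _ _ _ Nkj (wfP j')) eqxx in kj.
Qed.

Lemma mx_eval_lin (c : 'M[K]_n) A :
  mx_eval (\sum_i \sum_j c i j *: 'X_(mxvec_index i j)) A =
    \sum_i \sum_j c i j * A i j.
Proof.
rewrite /mx_eval raddf_sum /=; apply: eq_bigr => i _.
rewrite raddf_sum /=; apply: eq_bigr => j _.
by rewrite mevalZ mevalXU mxvecE.
Qed.

Lemma dtorus_diag Q A : Q \in unitmx -> dtorus Q A <->
  A \in unitmx /\ forall i j, i != j -> (invmx Q *m A *m Q) i j = 0.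
Proof.
move=> uQ; split=> -[uA h]; split=> //; [move=> i j ij | move=> j].
  have [a ha] := h j; rewrite -mulmxA mxE.
  rewrite (eq_bigr (fun k => a * (invmx Q i k * Q k j))); last by move=> k _;
    rewrite ha mulrCA.
  rewrite -mulr_sumr; have := congr1 (fun M : 'M[K]_n => M i j) (mulVmx uQ).
  by rewrite !mxE (negPf ij) => ->; rewrite mulr0.
exists ((invmx Q *m A *m Q) j j) => i.
have e : A *m Q = Q *m (invmx Q *m A *m Q) by rewrite !mulmxA mulmxV // mul1mx.
rewrite {1}e mxE (bigD1 j) //= big1 ?addr0 1?mulrC // => k kj.
by rewrite h // mulr0.
Qed.

Lemma dtorus_torus Q : Q \in unitmx -> torus (dtorus Q).
Proof.
move=> uQ; split; last first.
  exists (invmx Q); first by rewrite unitmx_inv.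
  move=> A /(dtorus_diag _ uQ)[uA h]; apply/diagonalizable_forP;
    first by rewrite unitmx_inv.
  by move=> i j ij; rewrite invmxK h.
split.
(* The equations are the off-diagonal entries of [invmx Q *m A *m Q], which are linear forms in the
   entries of [A]. *)
- pose c i j : 'M[K]_n := \matrix_(k, l) (invmx Q i k * Q l j).
  exists [set p | exists i j, i != j /\ p =
    \sum_k \sum_l c i j k l *: 'X_(mxvec_index k l)].
  have E A i j : \sum_k \sum_l c i j k l * A k l = (invmx Q *m A *m Q) i j.
    rewrite mxE exchange_big /=; apply: eq_bigr => l _; rewrite mxE mulr_suml.
    by apply: eq_bigr => k _; rewrite mxE mulrAC.
  apply/seteqP; split=> A.
    move=> /(dtorus_diag _ uQ)[uA h]; split=> // _ [i [j [ij ->]]].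
    by rewrite mx_eval_lin E h.
  move=> [uA h]; apply/(dtorus_diag _ uQ); split=> // i j ij.
  by rewrite -E -mx_eval_lin; apply: h; exists i, j.
- by split=> [|j]; rewrite ?unitmx1 //; exists 1 => i; rewrite mul1mx mul1r.
- move=> A B [uA hA] [uB hB]; split=> [|j]; first by rewrite unitmx_mul uA.
  have [a ha] := hA j; have [b hb] := hB j; exists (a * b) => i.
  rewrite -mulmxA mxE (eq_bigr (fun k => b * (A i k * Q k j)));
    last by move=> k _; rewrite hb mulrCA.
  by rewrite -mulr_sumr; have := ha i; rewrite mxE => ->; rewrite mulrCA mulrA.
- move=> A [uA hA]; split=> [|j]; first by rewrite unitmx_inv.
  have [a ha] := hA j.
  have colE : A *m col j Q = a *: col j Q.
    apply/colP => i; rewrite !mxE; have := ha i; rewrite mxE => <-.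
    by apply: eq_bigr => k _; rewrite mxE.
  have a0 : a != 0.
    apply/negP => /eqP a0; have [i] := col_neq0 j uQ; move=> /eqP; apply.
    have /(congr1 (mulmx (invmx A))) := colE.
    by rewrite mulKmx // a0 scale0r mulmx0 => /colP/(_ i); rewrite !mxE.
  exists a^-1 => i.
  have : invmx A *m col j Q = a^-1 *: col j Q.
    apply: (can_inj (mulKmx uA)); rewrite mulKVmx // -scalemxAr colE scalerA
      mulVf ?scale1r //.
  move/colP/(_ i); rewrite !mxE => <-; apply: eq_bigr => k _; by rewrite mxE.
Qed.

(** A torus diagonalised by [P] lies in [dtorus (invmx P)], so a maximal one equals it. Conversely,
    an inclusion between two such tori forces equal frames, so nothing larger contains
    [dtorus Q]. *)
Lemma maximal_torusP T : maximal_torus T <-> exists2 Q, Q \in unitmx & T =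
  dtorus Q.
Proof.
split=> [[[[[S ->] T1 TM TV] [P uP hP]] Tmax]|[Q uQ ->]].
  exists (invmx P); first by rewrite unitmx_inv.
  apply/esym/Tmax; first by apply: dtorus_torus; rewrite unitmx_inv.
  move=> A hA; apply/dtorus_diag; first by rewrite unitmx_inv.
  split; first by case: hA.
  by move=> i j ij; rewrite invmxK;
    apply: (elimT (diagonalizable_forP _ uP)) => //; exact: hP.
split; first exact: dtorus_torus.
move=> T' [alg [P uP hP]] sub.
have sub' : T' `<=` dtorus (invmx P).
  move=> A hA; apply/dtorus_diag; first by rewrite unitmx_inv.
  split; first by case: alg => -[S hS] _ _ _; move: hA; rewrite hS => -[].
  by move=> i j ij; rewrite invmxK;
    apply: (elimT (diagonalizable_forP _ uP)) => //; exact: hP.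
have uV : invmx P \in unitmx by rewrite unitmx_inv.
have := dtorus_sub uQ uV (subset_trans sub sub').
by move=> /same_lines_dtorus E; apply/seteqP; split=> //; rewrite E.
Qed.

Lemma frobM_unit Q : (frobM Q \in unitmx) = (Q \in unitmx).
Proof. exact: map_unitmx. Qed.

Lemma dtorus_frob Q : Q \in unitmx -> dtorus (frobM Q) = frobM @` dtorus Q.
Proof.
move=> uQ; apply/seteqP; split=> [A [uA hA]|_ [A [uA hA] <-]]; last first.
  split; first by rewrite frobM_unit.
  move=> j; have [a ha] := hA j; exists (phi a) => i.
  by rewrite -map_mxM !mxE -rmorphM /= -ha mxE.
pose B : 'M[K]_n := map_mx (fun x => sval (frobq_root iota x)) A.
have BA : frobM B = A by apply/matrixP => i j; rewrite !mxE; case: frobq_root.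
exists B => //; split; first by rewrite -frobM_unit BA.
move=> j; have [a ha] := hA j; exists (sval (frobq_root iota a)) => i.
apply: (fmorph_inj phi); rewrite rmorphM /=; case: frobq_root => b /= ->.
have := ha i; rewrite -BA -map_mxM !mxE => <-.
by [].
Qed.

Lemma map_mpoly_eval (g : {mpoly K[n * n]}) A : mx_eval (map_mpoly phi g)
  (frobM A) = phi (mx_eval g A).
Proof.
rewrite /mx_eval; elim/mpolyind: g => [|c m p _ _ IH]; first by rewrite !raddf0.
rewrite [map_mpoly _ _]rmorphD /= map_mpolyZ map_mpolyX !mevalD IH rmorphD
  !mevalZ !mevalX.
rewrite rmorphM /= rmorph_prod; congr (_ * _ + _).
by apply: eq_bigr => i _; rewrite rmorphXn -map_mxvec mxE.
Qed.

Lemma map_mpoly_iota (g : {mpoly F[n * n]}) : map_mpoly phi (map_mpoly iota g)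
  = map_mpoly iota g.
Proof. by apply/mpolyP => m; rewrite !mcoeff_map_mpoly /= frobq_iota. Qed.

Lemma map_mpoly_fixed (p : {mpoly K[n * n]}) : map_mpoly phi p = p ->
  exists g : {mpoly F[n * n]}, p = map_mpoly iota g.
Proof.
move=> hp; have h m : exists a, p@_m = iota a.
  by apply: frobq_fixP; rewrite -[in RHS]hp mcoeff_map_mpoly.
have [f hf] := choice h.
exists (\sum_(m <- msupp p) f m *: 'X_[m]); rewrite raddf_sum {1}(mpolyE p).
by apply: eq_bigr => m _; rewrite hf /= map_mpolyZ map_mpolyX.
Qed.

(** Galois descent, by induction on the number of monomials of [p]: the vanishing ideal is
    Frobenius-stable, and is shown to be spanned over [K] by its members with coefficients in
    [F]. *)
Lemma frob_stable_defined T : T `<=` frobM @` T -> defined_over iota T.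
Proof.
move=> Tst p pT.
have phiT g : vanishes_on T g -> vanishes_on T (map_mpoly phi g).
  by move=> hg A /Tst[B TB <-]; rewrite map_mpoly_eval hg ?rmorph0.
suff [m [c [g [hg ->]]]] : exists m (c : 'I_m -> K) (g : 'I_m ->
  {mpoly F[n * n]}),
    (forall j, vanishes_on T (map_mpoly iota (g j))) /\ p =
      \sum_j c j *: map_mpoly iota (g j).
  exists m, (fun j => (c j)%:MP), g; split=> //.
  by apply: eq_bigr => j _; rewrite mul_mpolyC.
have vsum m (c : 'I_m -> K) (g : 'I_m -> {mpoly F[n * n]}) :
    (forall j, vanishes_on T (map_mpoly iota (g j))) ->
    vanishes_on T (\sum_j c j *: map_mpoly iota (g j)).
  move=> hg A TA; rewrite /mx_eval raddf_sum big1 // => j _.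
  by rewrite /= mevalZ; have := hg j A TA; rewrite /mx_eval => ->;
    rewrite mulr0.
have [k] := ubnP (size (msupp p)); elim: k p pT => // k IH p pT;
  rewrite ltnS => hk.
have [->|p0] := eqVneq p 0.
  by exists 0%N, (fun=> 0), (fun=> 0); split=> [[]//|]; rewrite big_ord0.
have hl : mlead p \in msupp p by rewrite mlead_supp.
set m0 := mlead p in hl; set a := p@_m0.
have a0 : a != 0 by rewrite /a -mcoeff_msupp.
pose p1 := a^-1 *: p.
have p1T : vanishes_on T p1.
  by move=> A TA; rewrite /mx_eval mevalZ; have := pT A TA;
    rewrite /mx_eval => ->; rewrite mulr0.
(* The leading coefficient of [p1] is 1, hence cancels, and no new monomial appears: the support of
   [r] is strictly smaller. *)
pose r := map_mpoly phi p1 - p1.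
have rT : vanishes_on T r.
  move=> A TA; rewrite /mx_eval mevalB.
  have := phiT _ p1T A TA; have := p1T A TA; rewrite /mx_eval => -> ->;
    exact: subrr.
have rs : (size (msupp r) < size (msupp p))%N.
  apply: leq_ltn_trans (_ : size (rem m0 (msupp p)) < _)%N; last first.
    by rewrite size_rem // prednK // lt0n size_eq0; apply: contraTneq hl => ->.
  apply: uniq_leq_size; first exact: msupp_uniq.
  move=> m; rewrite mem_rem_uniq ?msupp_uniq // inE.
  apply: contraLR; rewrite negb_and negbK -!mcoeff_eq0.
  rewrite /r mcoeffB mcoeff_map_mpoly /p1 mcoeffZ /= => /orP[/eqP->|/eqP->].
    by rewrite mulVf // rmorph1 subrr.
  by rewrite mulr0 rmorph0 subrr.
have [m [c [g [hg rE]]]] := IH r rT (leq_trans rs hk).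
have hx j := frobq_sub_root iota (c j).
have [x xE] := choice hx.
(* Since [phi (x j) - x j = c j], this correction absorbs [r]: [p2] is fixed by Frobenius, so its
   coefficients lie in [F]. *)
pose p2 := p1 - \sum_j x j *: map_mpoly iota (g j).
have p2T : vanishes_on T p2.
  move=> A TA; rewrite /mx_eval mevalB.
  have := vsum _ x _ hg A TA; have := p1T A TA; rewrite /mx_eval => -> ->;
    exact: subrr.
have p2F : map_mpoly phi p2 = p2.
  have -> : map_mpoly phi p2 = map_mpoly phi p1 - \sum_j phi (x j) *: map_mpoly
    iota (g j).
    rewrite /p2 [LHS]rmorphB rmorph_sum /=; congr (_ - _);
      apply: eq_bigr => j _.
    by rewrite map_mpolyZ map_mpoly_iota.
  have -> : map_mpoly phi p1 = p1 + r by rewrite /r addrC subrK.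
  rewrite rE /p2 -addrA; congr (_ + _); rewrite -sumrB -sumrN;
    apply: eq_bigr => j _.
  rewrite -scalerBl -scaleNr; congr (_ *: _); rewrite -(xE j); ring.
have [g' gE] := map_mpoly_fixed p2F.
exists m.+1, (fun i => if unlift ord0 i is Some j then a * x j else a),
  (fun i => if unlift ord0 i is Some j then g j else g').
split=> [i|].
  by case: unliftP => [j _|_]; [exact: hg | rewrite -gE].
rewrite big_ord_recl unlift_none -gE.
under eq_bigr do rewrite liftK -scalerA.
rewrite -scaler_sumr -scalerDr /p2 subrK /p1 scalerA mulfV // scale1r //.
Qed.

Definition frob_cols Q (w : 'S_n) := forall i j, phi (Q i j) = Q i (w j).

Lemma frob_cols_same_lines Q w : frob_cols Q w -> same_lines (frobM Q) Q.
Proof.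
move=> h; exists w, (fun=> 1); split=> [j|i j]; first exact: oner_neq0.
by rewrite mxE h mulr1.
Qed.

(* Scaling each column so that its first nonzero entry is 1 makes the Frobenius
   map permute the columns themselves, not just the lines. *)
Lemma normalize_cols Q : Q \in unitmx -> same_lines (frobM Q) Q ->
  exists Q' w, [/\ Q' \in unitmx, frob_cols Q' w & dtorus Q' = dtorus Q].
Proof.
move=> uQ [w [e [e0 E]]].
pose piv j := odflt j [pick i | Q i j != 0].
have pivP j : Q (piv j) j != 0.
  by rewrite /piv; case: pickP => // h; have [i] := col_neq0 j uQ; rewrite h.
have pivw j : piv (w j) = piv j.
  rewrite /piv; have h i : (Q i (w j) != 0) = (Q i j != 0).
    have := E i j; rewrite mxE => Eij.
    by rewrite -(fmorph_eq0 phi (Q i j)) /= Eij mulf_eq0 (negPf (e0 j)) orbF.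
  rewrite (eq_pick h); case: pickP => // h'; have [i] := col_neq0 j uQ.
  by rewrite h'.
pose Q' : 'M[K]_n := \matrix_(i, j) (Q i j / Q (piv j) j).
have Q'E : Q' = Q *m diag_mx (\row_j (Q (piv j) j)^-1).
  by rewrite mul_mx_diag; apply/matrixP => i j; rewrite !mxE.
exists Q', w; split.
- rewrite Q'E unitmx_mul uQ /= unitmxE det_diag unitfE.
  by apply/prodf_neq0 => j _; rewrite mxE invr_eq0.
- move=> i j; rewrite !mxE fmorph_div /=.
  have := E i j; have := E (piv j) j; rewrite !mxE pivw => -> ->.
  by rewrite -mulf_div divff ?mulr1.
- apply: same_lines_dtorus; exists 1%g, (fun j => (Q (piv j) j)^-1);
  split=> [j|i j].
    by rewrite invr_eq0.
  by rewrite mxE perm1.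
Qed.

(** Equations generated over [F] still hold at Frobenius images of points. This puts the torus of
    [frobM Q] inside that of [Q], and [dtorus_sub] then makes the frame stable; the converse is
    descent. *)
Lemma max_toriP T : max_tori iota T <->
  exists Q w, [/\ Q \in unitmx, frob_cols Q w & T = dtorus Q].
Proof.
split=> [[/maximal_torusP[Q uQ ->] def]|[Q [w [uQ hw ->]]]]; last first.
  split; first by apply/maximal_torusP; exists Q.
  apply: frob_stable_defined; rewrite -dtorus_frob //.
  by rewrite (same_lines_dtorus (frob_cols_same_lines hw)).
suff /(normalize_cols uQ)[Q' [w [uQ' hw E]]] : same_lines (frobM Q) Q by exists
  Q', w.
apply: dtorus_sub; rewrite ?frobM_unit // dtorus_frob //.
move=> _ [A TA <-].
have [[[S TE] _ _ _] _] := dtorus_torus uQ.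
rewrite TE; split; first by rewrite frobM_unit; case: TA.
move=> p Sp.
have pT : vanishes_on (dtorus Q) p by rewrite TE => B [_]; exact.
have [m [c [g [hg ->]]]] := def p pT.
rewrite /mx_eval raddf_sum big1 // => j _; rewrite /= mevalM.
suff -> : (map_mpoly iota (g j)).@[fun i => mxvec (frobM A) 0 i] =
  0 by rewrite mulr0.
by rewrite -map_mpoly_iota -/(mx_eval _ _) map_mpoly_eval hg ?rmorph0.
Qed.

Lemma scale_lineP (u v : 'cV[K]_n) : u != 0 ->
  range (fun c : K => c *: u) = range (fun c : K => c *: v) ->
  exists2 e, e != 0 & u = e *: v.
Proof.
move=> u0 E; have : range (fun c : K => c *: u) u by exists 1; rewrite ?scale1r.
rewrite E => -[e _ ue]; exists e => //; apply: contraNneq u0 => e0.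
by rewrite -ue e0 scale0r.
Qed.

(** The torus contains an element with distinct eigenvalues on the columns of [Q], so a common
    eigenvector has only one nonzero coordinate in this frame. *)
Lemma dtorus_eigenlines Q : Q \in unitmx ->
  eigenlines (dtorus Q) = range (fun j => range (fun c : K => c *: col j Q)).
Proof.
move=> uQ; apply/seteqP; split=> [L [v [v0 -> hv]]|_ [j _ <-]]; last first.
  exists (col j Q); split=> //.
    have [i Qij] := col_neq0 j uQ; apply: contraNneq Qij => /colP/(_ i);
      by rewrite !mxE => ->.
  move=> A [uA /(_ j)[a ha]]; exists a; apply/colP => i; rewrite !mxE -ha mxE.
  by apply: eq_bigr => k _; rewrite mxE.
have [d [dI d0]] := regular_exists.
have [a ha] := hv _ (conj_diag_dtorus uQ d0).
pose c := invmx Q *m v.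
have vE : v = Q *m c by rewrite /c mulKVmx.
have dc j : c j 0 != 0 -> d 0 j = a.
  move=> cj; apply: (mulIf cj).
  have : diag_mx d *m c = a *: c.
    by rewrite /c scalemxAr -ha /conj_diag !mulmxA mulVmx // mul1mx.
  by move/colP/(_ j); rewrite mul_diag_mx !mxE.
clearbody c; have [j cj] : exists j, c j 0 != 0.
  apply/existsP; apply: contraNT v0; rewrite negb_exists => /forallP h.
  rewrite vE; suff -> : c = 0 by rewrite mulmx0.
  by apply/colP => j; rewrite [RHS]mxE; apply/eqP; rewrite -[_ == _]negbK.
have vj : v = c j 0 *: col j Q.
  rewrite vE; apply/colP => i; rewrite !mxE (bigD1 j) //= big1 ?addr0 1?mulrC
    // => k kj.
  have [->|ck] := eqVneq (c k 0) 0; first by rewrite mulr0.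
  by rewrite (dI k j) ?eqxx // in kj; rewrite (dc _ ck) (dc _ cj).
exists j => //; apply/seteqP; split=> _ [b _ <-].
  by exists (b / c j 0) => //; rewrite vj scalerA divfK.
by exists (b * c j 0) => //; rewrite vj scalerA.
Qed.

Lemma frob_cols_perm Q w : Q \in unitmx -> frob_cols Q w ->
  frob_perm F (dtorus Q) w.
Proof.
move=> uQ hw; exists (fun j => range (fun c : K => c *: col j Q)); split.
- move=> i j E.
  have ui : col i Q != 0.
    have [k Qki] := col_neq0 i uQ; apply: contraNneq Qki => /colP/(_ k);
      by rewrite !mxE => ->.
  have [e e0 ij] := scale_lineP ui E.
  apply/eqP; apply: contraT => nij.
  have hc k : invmx Q *m col k Q = delta_mx k 0 by rewrite colE mulKmx.
  have := congr1 (fun v : 'cV[K]_n => (invmx Q *m v) i 0) ij;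
    rewrite -scalemxAr !hc.
  by rewrite !mxE !eqxx (negPf nij) mulr0 => /eqP; rewrite oner_eq0.
- by rewrite dtorus_eigenlines.
- move=> j; have frobE (v : 'cV[K]_n) : frob F v = map_mx phi v by [].
  have fcol : map_mx phi (col j Q) = col (w j) Q by apply/colP => i;
    rewrite !mxE hw.
  apply/seteqP; split=> [_ [_ [c _ <-] <-]|_ [c _ <-]].
    by exists (phi c) => //; rewrite frobE map_mxZ fcol.
  have [b bc] := frobq_root iota c.
  exists (b *: col j Q); first by exists b.
  by rewrite frobE map_mxZ fcol /= bc.
Qed.

Lemma frob_perm_conj T (s s' : 'S_n) : frob_perm F T s -> frob_perm F T s' ->
  exists t : 'S_n, s' = (s ^ t)%g.
Proof.
move=> [L [LI LR Ls]] [L' [LI' LR' Ls']].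
have h i : exists j, L' j = L i.
  have : range L' (L i) by rewrite LR' -LR; exists i.
  by move=> [j _ e]; exists j.
have [t tE] := choice h.
have tI : injective t by move=> i j e; apply: LI; rewrite -!tE e.
exists (perm tI); apply/permP => j.
rewrite conjgE !permM -[j in LHS](permKV (perm tI)).
move: (((perm tI)^-1)%g j) => i; rewrite !permE.
by apply: LI'; rewrite -Ls' !tE Ls.
Qed.

Lemma num_cycles_sigma Q w j : Q \in unitmx -> frob_cols Q w ->
  num_cycles j (sigma F (dtorus Q)) = num_cycles j w.
Proof.
move=> uQ hw; have h := frob_cols_perm uQ hw.
have hs : frob_perm F (dtorus Q) (sigma F (dtorus Q)).
  exact: (@xgetPex _ 1%g [set s | frob_perm F (dtorus Q) s] (ex_intro _ _ h)).
by have [t ->] := frob_perm_conj h hs; rewrite num_cyclesJ.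
Qed.

End DiagonalTori.

(** * Counting Frobenius-stable tori *)

Section CountingTori.
Import Order.TTheory.
Local Open Scope ring_scope.

Variables (F : finFieldType) (K : closedFieldType) (iota : {rmorphism F -> K}).
Variable n : nat.
Local Notation q := #|F|.
Local Notation phi := (frobq iota).
Local Notation frobM := (map_mx phi).

Lemma card_unitmx :
  #|[pred G : 'M[F]_n.+1 | G \in unitmx]| =
  (q ^ 'C(n.+1, 2) * \prod_(1 <= i < n.+2) (q ^ i - 1))%N.
Proof. by rewrite -(card_GL _ (ltn0Sn n)) cardsT card_sub. Qed.

(** Frobenius permutes the columns of [B] and of [C *m B] alike, so [C] and its Frobenius image have
    the same product with [B]; independence of the rows of [B] makes them equal. *)
Lemma fixed_coords k m l (w : 'S_m) (B : 'M[K]_(k, m)) (C : 'M[K]_(l, k)) :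
  row_free B ->
  (forall i j, phi (B i j) = B i (w j)) ->
  (forall i j, phi ((C *m B) i j) = (C *m B) i (w j)) ->
  exists C', C = map_mx iota C'.
Proof.
move=> fB hB hC.
have : map_mx phi C *m B = C *m B.
  apply/matrixP => i j; rewrite -[j](permKV w) -hC !mxE rmorph_sum;
    apply: eq_bigr => a _.
  by rewrite rmorphM /= hB permKV !mxE.
move=> /(row_free_inj fB) /matrixP e.
have h i j : exists a, C i j = iota a.
  by apply: frobq_fixP; have := e i j; rewrite mxE.
exists (\matrix_(i, j) sval (cid (h i j))); apply/matrixP => i j.
by rewrite !mxE; case: cid.
Qed.

(** The exponent [(n.+1)!] serves twice. It kills every [w], so the entries of frames and the
    scalings lie in [r]; and it is divisible by every cycle length, so [r] contains the fixed points
    of the corresponding iterates. *)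
Variable r : seq K.
Hypothesis mem_r : forall x, (x \in r) = (iter (n.+1)`! phi x == x).
Local Notation E := (seq_sub r).

Lemma mem_rM x y : x \in r -> y \in r -> x * y \in r.
Proof. by rewrite !mem_r !iter_frobq exprMn => /eqP-> /eqP->. Qed.

Lemma mem_r_phi x : x \in r -> phi x \in r.
Proof. by rewrite !mem_r -iterSr iterS => /eqP->. Qed.

Definition phiE (x : E) : E := insubd x (phi (val x)).

Lemma val_phiE x : val (phiE x) = phi (val x).
Proof. by rewrite val_insubd mem_r_phi // (valP x). Qed.

Lemma val_iter_phiE l x : val (iter l phiE x) = iter l phi (val x).
Proof. by elim: l => //= l <-; rewrite val_phiE. Qed.

Definition mulE (x y : E) : E := insubd x (val x * val y).

Lemma val_mulE x y : val (mulE x y) = val x * val y.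
Proof. by rewrite val_insubd mem_rM // ?(valP x) ?(valP y). Qed.

Lemma card_fixE l : (0 < l <= n.+1)%N ->
  #|[pred x : E | iter l phiE x == x]| = (q ^ l)%N.
Proof.
move=> /andP[l0 ln]; have [s [us ss sP]] := fix_seq_exists iota l0.
rewrite -ss cardE -(size_map val); apply: perm_size; apply: uniq_perm => //.
  by rewrite map_inj_uniq ?enum_uniq //; exact: val_inj.
move=> x; rewrite sP; apply/mapP/idP => [[y]|hx].
  by rewrite mem_enum inE => /eqP e ->; rewrite -val_iter_phiE e.
have xr : x \in r.
  rewrite mem_r; have /dvdnP[k ->] : (l %| (n.+1)`!)%N by rewrite dvdn_fact ?l0.
  by elim: k => //= k /eqP e; rewrite mulSn iterD e.
exists (SeqSub xr) => //; rewrite mem_enum inE; apply/eqP/val_inj.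
by rewrite val_iter_phiE /= (eqP hx).
Qed.

Lemma card_porbit_bounds (w : 'S_n.+1) c : c \in porbits w ->
  (0 < #|c| <= n.+1)%N.
Proof.
move=> /imsetP[x _ ->]; rewrite lt0n card_porbit_neq0 /=.
by apply: leq_trans (max_card _) _; rewrite card_ord.
Qed.

Lemma sum_card_porbits (w : 'S_n.+1) : (\sum_(c in porbits w) #|c| = n.+1)%N.
Proof.
rewrite -[RHS]card_ord -[RHS]sum1_card [RHS](partition_big (porbit w) (mem
  (porbits w))) /=; last first.
  by move=> i _; apply: imset_f.
apply: eq_bigr => c /imsetP[x _ ->]; rewrite sum1dep_card; apply: eq_card => i.
by rewrite !inE eq_porbit_mem.
Qed.

Local Notation equivar w := (fun u : {ffun 'I_n.+1 ->
  E} => [forall j, u (w j) == phiE (u j)]).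

Lemma card_equivar (w : 'S_n.+1) : #|[pred u | equivar w u]| = (q ^ n.+1)%N.
Proof.
have := sum_equivariant w phiE (fun=> 1 : rat).
rewrite [X in X = _](eq_bigr (fun=> 1)); last by move=> u _; rewrite big1.
rewrite sumr_const (eq_bigr (fun c : {set 'I_n.+1} => (q ^ #|c|)%:R));
  last first.
  move=> c hc; rewrite (eq_bigr (fun=> 1)); last by move=> u _; rewrite big1.
  by rewrite sumr_const card_fixE // (card_porbit_bounds hc).
rewrite -natr_prod -expn_sum sum_card_porbits => /eqP;
  rewrite eqr_nat => /eqP <-.
by apply: eq_card.
Qed.

(** The rows of [A] are all q^(n+1) equivariant vectors. By [fixed_coords] each is a combination
    over [F] of [\rank A] independent ones, so q^(n+1) is at most q to the rank, and [A] has full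
    rank. *)
Lemma frob_cols_exists (w : 'S_n.+1) :
  exists2 Q : 'M[K]_n.+1, Q \in unitmx & frob_cols iota Q w.
Proof.
pose U := {u : {ffun 'I_n.+1 -> E} | equivar w u}.
pose ev (k : 'I_#|{: U}|) : U := enum_val k.
pose A : 'M[K]_(#|{: U}|, n.+1) := \matrix_(k, j) val (sval (ev k) j).
have hA k j : phi (A k j) = A k (w j).
  by rewrite !mxE -val_phiE; congr val; apply/esym/eqP;
    exact: (forallP (svalP (ev k))).
have rA : (n.+1 <= \rank A)%N.
  pose B := rowsub (maxrankfun A) A.
  have BE k j : B k j = A (maxrankfun A k) j by rewrite [LHS]mxE.
  have hB k j : phi (B k j) = B k (w j) by rewrite !BE hA.
  have fB : row_free B := maxrowsub_free A.
  have hc (u : U) : exists c : 'rV[F]_(\rank A), row (enum_rank u) A =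
    map_mx iota c *m B.
    have /submxP[C CE] : (row (enum_rank u) A <= B)%MS by rewrite eq_maxrowsub
      row_sub.
    have [|C' C'E] := fixed_coords (C := C) fB hB.
      have RE i j : row (enum_rank u) A i j =
        A (enum_rank u) j by rewrite [LHS]mxE.
      by move=> i j; rewrite -CE !RE hA.
    by exists C'; rewrite -C'E.
  have [f hf] := choice hc.
  have fI : injective f.
    move=> u v e; apply: val_inj; apply/ffunP => j; apply: val_inj.
    have := hf u; rewrite e -(hf v) => /rowP/(_ j);
      rewrite !mxE /ev !enum_rankK.
    by [].
  have cU : #|{: U}| = (q ^ n.+1)%N by rewrite card_sig -(card_equivar w);
    apply: eq_card.
  have := leq_card f fI; rewrite card_mx mul1n => h.
  have : (q ^ n.+1 <= q ^ \rank A)%N by rewrite -cU.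
  by rewrite leq_exp2l // card_field_gt1.
have fA : row_full A by rewrite /row_full eqn_leq rank_leq_col rA.
exists (rowsub (fullrankfun fA) A);
  first by rewrite -row_full_unit fullrowsub_full.
by move=> i j; rewrite !mxE; have := hA (fullrankfun fA i) j; rewrite !mxE.
Qed.

Definition mval (M : 'M[E]_n.+1) : 'M[K]_n.+1 := map_mx val M.

Definition good (w : 'S_n.+1) (M : 'M[E]_n.+1) :=
  (mval M \in unitmx) && [forall i, forall j, phiE (M i j) == M i (w j)].

Lemma mval_inj : injective mval.
Proof.
by move=> M N /matrixP e; apply/matrixP => i j; apply: val_inj; have := e i j;
  rewrite !mxE.
Qed.

Lemma goodP w M : reflect (mval M \in unitmx /\ frob_cols iota (mval M) w)
  (good w M).
Proof.
apply: (iffP andP) => -[uM h]; split=> //.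
  move=> i j; rewrite !mxE -val_phiE; congr val; apply/eqP.
  by move/forallP/(_ i)/forallP: h.
apply/forallP => i; apply/forallP => j; apply/eqP/val_inj.
by have := h i j; rewrite !mxE val_phiE.
Qed.

Lemma good_lift Q (w : 'S_n.+1) : Q \in unitmx -> frob_cols iota Q w ->
  exists2 M, good w M & mval M = Q.
Proof.
move=> uQ hw.
have mr i j : Q i j \in r.
  have it k : iter k phi (Q i j) = Q i ((w ^+ k)%g j).
    by elim: k => [|k IH] /=; rewrite ?expg0 ?perm1 // IH hw expgSr permM.
  rewrite mem_r it -card_Sn -cardsT expg_cardG ?finset.in_setT //.
  by rewrite perm1.
pose M : 'M[E]_n.+1 := \matrix_(i, j) SeqSub (mr i j).
have ME : mval M = Q by apply/matrixP => i j; rewrite !mxE.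
by exists M => //; apply/goodP; rewrite ME.
Qed.

Lemma card_good (w : 'S_n.+1) :
  #|[pred M : 'M[E]_n.+1 | good w M]| = #|[pred G : 'M[F]_n.+1 | G \in unitmx]|.
Proof.
have [Q0 u0 h0] := frob_cols_exists w.
have f0 : row_free Q0 by rewrite row_free_unit.
have hG (G : 'M[F]_n.+1) : G \in unitmx ->
    exists2 M, good w M & mval M = map_mx iota G *m Q0.
  move=> uG; apply: good_lift; first by rewrite unitmx_mul map_unitmx uG.
  move=> i j; rewrite !mxE rmorph_sum; apply: eq_bigr => k _.
  by rewrite rmorphM /= h0 mxE frobq_iota.
have [M0 _ _] := good_lift u0 h0.
(* [M0] is only a default, for matrices [G] that are not invertible. *)
pose h (G : 'M[F]_n.+1) : 'M[E]_n.+1 :=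
  if pselect (exists2 M, good w M & mval M =
    map_mx iota G *m Q0) is left e then s2val (cid2 e) else M0.
have hE G : G \in unitmx -> good w (h G) /\ mval (h G) = map_mx iota G *m Q0.
  by move=> uG; rewrite /h; case: pselect => [e|]; [case: cid2 | move=> [];
    exact: hG].
have hI : {in [pred G : 'M[F]_n.+1 | G \in unitmx] &, injective h}.
  move=> G H; rewrite !inE => /hE[_ eG] /hE[_ eH] e.
  have := congr1 mval e; rewrite eG eH => /(row_free_inj f0).
  move=> /matrixP e'; apply/matrixP => i j; apply: (fmorph_inj iota).
  by have := e' i j; rewrite !mxE.
rewrite -(card_in_imset hI); apply: eq_card => M; rewrite !inE.
apply/idP/imsetP => [gM|[G]]; last by rewrite inE => /hE[gG _] ->.
have /goodP[uM hM] := gM.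
have QE : mval M *m invmx Q0 *m Q0 = mval M by rewrite mulmxKV.
have [|G GE] := fixed_coords (C := mval M *m invmx Q0) f0 h0;
  first by rewrite QE.
have uG : G \in unitmx by rewrite -(map_unitmx iota) -GE unitmx_mul uM
  unitmx_inv.
exists G; first by rewrite inE.
by apply: mval_inj; rewrite (hE _ uG).2 -GE QE.
Qed.

Lemma cols_proportional (Q : 'M[K]_n.+1) j k c : Q \in unitmx ->
  (forall i, Q i j = Q i k * c) -> j = k.
Proof.
move=> uQ h; apply/eqP; apply: contraT => jk.
have := congr1 (fun A : 'M[K]_n.+1 => A j j) (mulVmx uQ).
rewrite !mxE eqxx (eq_bigr (fun i => invmx Q j i * Q i k * c));
  last by move=> i _; rewrite h mulrA.
rewrite -mulr_suml; have := congr1 (fun A : 'M[K]_n.+1 => A j k) (mulVmx uQ).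
by rewrite !mxE (negPf jk) => ->; rewrite mul0r => /eqP;
  rewrite eq_sym oner_eq0.
Qed.

(** * Fibres of the map from frames to tori *)

Section Fibres.
Variable R : numFieldType.

Definition tdenom (w : 'S_n.+1) : R :=
  \prod_(c in porbits w) (q%:R ^+ #|c| - 1).

Lemma tdenom_neq0 w : tdenom w != 0.
Proof.
apply/prodf_neq0 => c /card_porbit_bounds/andP[c0 _].
rewrite subr_eq0 gt_eqF // -natrX -[1]/(1%:R) ltr_nat.
by rewrite -(exp1n #|c|) ltn_exp2r // card_field_gt1.
Qed.

(** Weighting [sum_equivariant] by the indicator of nonzero elements, a cycle [c] contributes the
    nonzero fixed points of the iterate of Frobenius of order [#|c|]. *)
Lemma card_scalings (w : 'S_n.+1) :
  #|[pred u : {ffun 'I_n.+1 -> E} |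
      equivar w u && [forall j, val (u j) != 0]]|%:R = tdenom w.
Proof.
have := sum_equivariant w phiE (fun x : E => (val x != 0)%:R : R).
have E1 (u : {ffun 'I_n.+1 -> E}) :
    \prod_i ((val (u i) != 0)%:R : R) = [forall j, val (u j) != 0]%:R.
  case: forallP => [h|/forallP]; first by rewrite big1 // => i _; rewrite h.
  by rewrite negb_forall => /existsP[j hj];
    rewrite (bigD1 j) //= (negPf hj) mul0r.
rewrite [X in X = _](eq_bigr (fun u : {ffun 'I_n.+1 ->
  E} => [forall j, val (u j) != 0]%:R)).
  2: by move=> u _; exact: E1.
move=> e; rewrite -sum1_card natr_sum (eq_bigl (fun u =>
  equivar w u && [forall j, val (u j) != 0])) //.
rewrite big_mkcondr /= [LHS](eq_bigr (fun u : {ffun 'I_n.+1 ->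
  E} => [forall j, val (u j) != 0]%:R)); last first.
  by move=> u _; case: [forall _, _].
rewrite e; apply: eq_bigr => c hc; have /andP[c0 cn] := card_porbit_bounds hc.
have it0 k x : (val (iter k phiE x) != 0) = (val x != 0).
  by rewrite val_iter_phiE iter_frobq expf_eq0 expn_gt0 ltnW ?card_field_gt1.
rewrite (eq_bigr (fun x : E => (val x != 0)%:R)); last first.
  move=> x _; under eq_bigr do rewrite it0.
  rewrite prodr_const card_ord; case: (val x != 0); first by rewrite expr1n.
  by rewrite expr0n gtn_eqF.
have r0 : 0 \in r by rewrite mem_r iter_frobq expr0n gtn_eqF // expn_gt0 ltnW
  ?card_field_gt1.
rewrite (bigD1 (SeqSub r0)) /=; last first.
  by apply/eqP/val_inj; rewrite val_iter_phiE /= iter_frobq expr0n gtn_eqF //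
    expn_gt0 ltnW ?card_field_gt1.
rewrite eqxx add0r (eq_bigr (fun=> 1)); last first.
  move=> x /andP[_]; rewrite -val_eqE /= => ->; exact: erefl.
have := card_fixE (l := #|c|); rewrite c0 cn => /(_ isT) cE.
have h0 : SeqSub r0 \in [pred x : E | iter #|c| phiE x == x].
  by rewrite inE; apply/eqP/val_inj;
    rewrite val_iter_phiE /= iter_frobq expr0n gtn_eqF // expn_gt0 ltnW
    ?card_field_gt1.
rewrite -natrX -cE (cardD1 (SeqSub r0)) h0 natrD addrC addKr sumr_const.
by congr (_%:R); apply: eq_card => x; rewrite !inE andbC.
Qed.

Definition good_pairs : pred ('S_n.+1 * 'M[E]_n.+1) := fun x => good x.1 x.2.

(** Equal tori have frames differing by a permutation [t] and scalars [e]. Applying Frobenius to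
    this relation and using the independence of the columns of [M0] shows that [t] intertwines [w]
    with [w0] and that [e] is equivariant. *)
Lemma good_pairs_same w0 M0 w M : good w0 M0 -> good w M ->
  dtorus (mval M) = dtorus (mval M0) ->
  exists (t : 'S_n.+1) (e : {ffun 'I_n.+1 -> E}),
   [/\ w = (w0 ^ t^-1)%g, [forall j, val (e j) != 0], equivar w e
     & M = \matrix_(i, j) mulE (M0 i (t j)) (e j)].
Proof.
move=> /goodP[u0 h0] /goodP[u1 h1] E0.
have [t [e [e0 eE]]] : same_lines (mval M) (mval M0) by apply: (dtorus_sub
  iota) => //; rewrite E0.
have h j : t (w j) = w0 (t j) /\ e (w j) = phi (e j).
  have hh i : mval M0 i (w0 (t j)) * phi (e j) = mval M0 i (t (w j)) * e (w j).
    by rewrite -h0 -rmorphM /= -eE h1 eE.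
  have tw : t (w j) = w0 (t j).
    apply/esym/(@cols_proportional _ _ _ (e (w j) / phi (e j)) u0) => i.
    by apply: (mulIf (_ : phi (e j) != 0));
      rewrite ?fmorph_eq0 // hh mulrA divfK ?fmorph_eq0.
  split=> //; have [i hi] := col_neq0 (w0 (t j)) u0.
  by apply: (mulfI hi); rewrite hh tw.
have er j : e j \in r.
  have it k : iter k phi (e j) = e ((w ^+ k)%g j).
    by elim: k => [|k IH] /=; rewrite ?expg0 ?perm1 // IH -(h _).2 expgSr permM.
  by rewrite mem_r it -card_Sn -cardsT expg_cardG ?finset.in_setT // perm1.
exists t, [ffun j => SeqSub (er j)]; split.
- apply/permP => j; apply: (@perm_inj _ t); rewrite (h j).1.
  by rewrite conjgE invgK !permM permKV.
- by apply/forallP => j; rewrite ffunE /= e0.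
- by apply/forallP => j; rewrite !ffunE; apply/eqP/val_inj;
  rewrite val_phiE /= (h j).2.
- apply: mval_inj; apply/matrixP => i j; rewrite eE !mxE val_mulE ffunE //.
Qed.

Lemma good_pairs_scale w0 M0 t (e : {ffun 'I_n.+1 -> E}) : good w0 M0 ->
  [forall j, val (e j) != 0] -> equivar (w0 ^ t^-1)%g e ->
  let M := \matrix_(i, j) mulE (M0 i (t j)) (e j) in
  good (w0 ^ t^-1)%g M /\ same_lines (mval M) (mval M0).
Proof.
move=> /goodP[u0 h0] /forallP e0 /forallP eE M.
have sl : same_lines (mval M) (mval M0).
  by exists t, (fun j => val (e j)); split=> // i j; rewrite !mxE val_mulE.
split=> //; apply/goodP; split.
  have -> : mval M = mval M0 *m (diag_mx (\row_j val (e (t^-1%g j))) *m perm_mx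
    t^-1%g).
    apply/matrixP => i j; rewrite mulmxA mul_mx_diag.
    by rewrite -col_permE !mxE val_mulE permK.
  rewrite !unitmx_mul u0 unitmx_perm andbT /= unitmxE det_diag unitfE.
  by apply/prodf_neq0 => j _; rewrite mxE e0.
move=> i j; rewrite !mxE !val_mulE rmorphM /= -[phi (val (e j))]val_phiE -(eqP
  (eE j)).
have := h0 i (t j); rewrite !mxE => ->; congr (val (M0 i _) * _).
by rewrite conjgE invgK !permM permKV.
Qed.

(** The fibre is parametrised by a column permutation and a scaling adapted to the conjugated type;
    conjugation preserves cycle lengths, hence the number of scalings. *)
Lemma card_fibre w0 M0 : good w0 M0 ->
  #|[pred x | good_pairs x && `[< dtorus (mval x.2) = dtorus (mval M0) >]]|%:R =
  (n.+1)`!%:R * tdenom w0.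
Proof.
move=> g0.
pose Y := [pred y : 'S_n.+1 * {ffun 'I_n.+1 -> E} |
  equivar (w0 ^ y.1^-1)%g y.2 && [forall j, val (y.2 j) != 0]].
pose h (y : 'S_n.+1 * {ffun 'I_n.+1 -> E}) : 'S_n.+1 * 'M[E]_n.+1 :=
  ((w0 ^ y.1^-1)%g, \matrix_(i, j) mulE (M0 i (y.1 j)) (y.2 j)).
have hI : {in Y &, injective h}.
  move=> [t e] [t' e']; rewrite !inE /= =>
    /andP[_ /forallP e0] /andP[_ /forallP e0'] [_ /matrixP E1].
  have {}E1 i j : val (M0 i (t j)) * val (e j) = val (M0 i (t' j)) * val (e' j).
    by have := congr1 val (E1 i j); rewrite !mxE !val_mulE.
  have /goodP[u0 _] := g0.
  have tt' j : t j = t' j.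
    apply: (@cols_proportional _ _ _ (val (e' j) / val (e j)) u0) => i.
    by apply: (mulIf (e0 j)); rewrite !mxE E1 mulrA divfK ?e0.
  have ee' j : e j = e' j.
    have [i] := col_neq0 (t j) u0; rewrite mxE => hi; apply: val_inj;
      apply: (mulfI hi).
    by rewrite E1 tt'.
  by congr (_, _); [apply/permP | apply/ffunP].
have -> : #|[pred x | good_pairs x && `[< dtorus (mval x.2) =
  dtorus (mval M0) >]]| = #|Y|.
  rewrite -(card_in_imset hI); apply: eq_card => -[w M];
    rewrite inE /good_pairs /=.
  apply/andP/imsetP => [[gM /asboolP E1]|[[t e]]].
    have [t [e [-> e0 we ME]]] := good_pairs_same g0 gM E1.
    by exists (t, e); [rewrite inE /= we | rewrite /h -ME].
  rewrite inE /= => /andP[we e0] [-> ->].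
  have [gM sl] := good_pairs_scale g0 e0 we; split=> //.
  by apply/asboolP/same_lines_dtorus.
rewrite -sum1_card natr_sum.
rewrite (eq_bigl (fun y => true && (equivar (w0 ^ y.1^-1)%g y.2 && [forall j,
  val (y.2 j) != 0]))) //.
rewrite -(pair_big_dep xpredT (fun t e =>
  equivar (w0 ^ t^-1)%g e && [forall j, val (e j) != 0]) (fun _ _ => 1)) /=.
rewrite (eq_bigr (fun=> tdenom w0)) ?sumr_const ?card_Sn ?mulr_natl // => t _.
rewrite -(_ : tdenom (w0 ^ t^-1)%g = tdenom w0).
  by rewrite -card_scalings sumr_const; congr (_%:R); apply: eq_card => e;
    rewrite inE.
by rewrite /tdenom (prod_porbitsJ _ _ (fun c => q%:R ^+ c - 1)).
Qed.

Local Open Scope classical_set_scope.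

Lemma good_tdenom w M w' M' : good w M -> good w' M' ->
  dtorus (mval M') = dtorus (mval M) -> tdenom w' = tdenom w.
Proof.
move=> /goodP[u h] /goodP[u' h'] E0.
rewrite /tdenom !(prod_porbits _ (fun c => q%:R ^+ c - 1 : R) (leqnn _)).
apply: eq_bigr => j _; congr (_ ^+ _).
by rewrite -(num_cycles_sigma j u h) -E0 (num_cycles_sigma j u' h').
Qed.

Lemma sum_max_tori (f : set 'M[K]_n.+1 -> R) (g : 'S_n.+1 -> R) :
  (forall w M, good w M -> f (dtorus (mval M)) = g w) ->
  \sum_(T \in @max_tori F K iota n.+1) f T =
  (#|[pred G : 'M[F]_n.+1 | G \in unitmx]|%:R / (n.+1)`!%:R) * \sum_w g w /
    tdenom w.
Proof.
move=> fg.
pose dt (x : 'S_n.+1 * 'M[E]_n.+1) := dtorus (mval x.2).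
pose s := undup [seq dt x | x <- enum good_pairs].
have sE : @max_tori F K iota n.+1 = [set` s].
  apply/seteqP; split=> T /=.
    move=> /max_toriP[Q [w [uQ hw ->]]]; have [M gM ME] := good_lift uQ hw.
    rewrite /= mem_undup; apply/mapP; exists (w, M); first by rewrite mem_enum.
    by rewrite /dt /= ME.
  rewrite /= mem_undup => /mapP[[w M]]; rewrite mem_enum => gM ->.
  have /goodP[uM hM] : good w M := gM.
  by apply/max_toriP; exists (mval M), w.
rewrite sE -fsbig_seq ?undup_uniq //.
(* Each torus is spread evenly over its fibre; the weight is constant there by [good_tdenom], and
   [card_fibre] makes the weights add up to 1. *)
transitivity (\sum_(T <- s) \sum_(x | good_pairs x && (dt x == T)) f T /
  ((n.+1)`!%:R * tdenom x.1)).
  apply: eq_big_seq => T; rewrite mem_undup => /mapP[[w M]];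
    rewrite mem_enum => gM ->.
  have gM' : good w M := gM.
  rewrite (eq_bigr (fun=> f (dt (w, M)) / ((n.+1)`!%:R * tdenom w)));
    last first.
    by move=> [w' M'] /andP[gM1 /eqP E1]; rewrite (good_tdenom gM' gM1 E1).
  have fn0 : (n.+1)`!%:R != 0 :> R by rewrite pnatr_eq0 -lt0n fact_gt0.
  rewrite sumr_const -[RHS]mulr_natr [X in _ = _ * X](_ : _ =
    (n.+1)`!%:R * tdenom w).
    by rewrite divfK // mulf_neq0 ?tdenom_neq0.
  rewrite -(card_fibre gM'); congr (_%:R).
rewrite (exchange_big_dep good_pairs) /=; last by move=> T x _ /andP[].
rewrite (eq_bigr (fun x => g x.1 / ((n.+1)`!%:R * tdenom x.1))); last first.
  move=> x gx; rewrite (eq_bigl (pred1 (dt x))); last by move=> T;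
    rewrite gx eq_sym.
  have dts : dt x \in s by rewrite mem_undup map_f // mem_enum.
  rewrite big_mkcond (bigD1_seq _ dts (undup_uniq _)) /= eqxx big1 ?addr0;
    last by move=> T /negPf ->.
  by rewrite -(fg _ _ gx).
rewrite (eq_bigl (fun x => true && good x.1 x.2)) //.
rewrite -(pair_big_dep xpredT (fun w M => good w M) (fun w _ =>
  g w / ((n.+1)`!%:R * tdenom w))) /=.
rewrite mulr_sumr; apply: eq_bigr => w _;
  rewrite sumr_const card_good -mulr_natr invfM; ring.
Qed.

End Fibres.
End CountingTori.

(** * The torus average as a value at 1/q *)

Section TorusAverage.
Local Open Scope classical_set_scope.
Local Open Scope ring_scope.
Import Order.TTheory.

Variables (R : realType) (F : finFieldType) (K : closedFieldType) (iota :
  {rmorphism F -> K}).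
Variables (k : nat) (P : {mpoly rat[k]}).
Local Notation q := (#|F|%:R : R).

(** Adds the explicit power of q in the order of GL_N to the one obtained by extracting q^i from
    each factor q^i - 1. *)
Lemma bin2_add N : ('C(N, 2) + 'C(N.+1, 2) = N ^ 2)%N.
Proof.
rewrite -mulnn; elim: N => // N IH.
have := binS N 1; have := binS N.+1 1; rewrite !bin1 => e1 e2.
by rewrite e1; move: IH; rewrite e2; lia.
Qed.

Lemma q_gt1 : 1 < q.
Proof. by rewrite -[1]/(1%:R) ltr_nat card_field_gt1. Qed.

Lemma tdenomE n (w : 'S_n.+1) :
  tdenom F R w = q ^+ n.+1 * evx q^-1 (cycle_weight w).
Proof.
have q0 : q != 0 by rewrite gt_eqF // (lt_trans _ q_gt1).
rewrite evx_prod -[in q ^+ _](sum_card_porbits w) -prodrXr -big_split /=.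
apply: eq_bigr => c _; rewrite evx_1BXn mulrBr mulr1 -exprMn divff // expr1n //.
Qed.

Lemma card_unitmxE n : #|[pred G : 'M[F]_n.+1 | G \in unitmx]|%:R =
  q ^+ (n.+1 ^ 2) * evx q^-1 (\prod_(i < n.+1) (1 - 'X^(i.+1))).
Proof.
have q0 : q != 0 by rewrite gt_eqF // (lt_trans _ q_gt1).
rewrite card_unitmx natrM natrX natr_prod big_add1 /= big_mkord evx_prod.
rewrite -bin2_add exprD -mulrA; congr (_ * _).
rewrite -bin2_sum big_nat_recl // add0n big_mkord -prodrXr -big_split /=.
apply: eq_bigr => i _; rewrite evx_1BXn mulrBr mulr1 -exprMn divff // expr1n.
by rewrite natrB ?natrX // expn_gt0 ltnW ?card_field_gt1.
Qed.

(** Molien's formula at 1/q: the numerator is the order of GL_N over q^(N^2) and the denominator is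
    [tdenom] over q^N, with N = n+1. This is the origin of the exponent N^2 - N. *)
Lemma evx_chip n (w : 'S_n.+1) : evx q^-1 (chip w) =
  (q ^+ (n.+1 ^ 2 - n.+1))^-1 * (#|[pred G : 'M[F]_n.+1 | G \in unitmx]|%:R /
    tdenom F R w).
Proof.
have q0 : q != 0 by rewrite gt_eqF // (lt_trans _ q_gt1).
have D0 := tdenom_neq0 F R w.
have qE : q ^+ (n.+1 ^ 2) = q ^+ (n.+1 ^ 2 - n.+1) * q ^+ n.+1.
  by rewrite -exprD subnK // -[X in (X <= _)%N]expn1 leq_pexp2l.
have a0 : q ^+ (n.+1 ^ 2 - n.+1) != 0 by rewrite expf_neq0.
apply: (mulIf D0); rewrite -!mulrA mulVf // mulr1 card_unitmxE -(chip_molien w)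
  evxM.
rewrite -/(cycle_weight w) tdenomE qE -!mulrA mulKf //.
by rewrite mulrCA.
Qed.

Lemma evx_sum (I : finType) (f : I -> {poly rat}) (x : R) :
  evx x (\sum_i f i) = \sum_i evx x (f i).
Proof.
elim/big_rec2: _ => [|i p s _ <-]; last by rewrite evxD.
by rewrite /evx rmorph0 horner0.
Qed.

Lemma torus_avgE n :
  (q ^+ (n.+1 ^ 2 - n.+1))^-1 *
    \sum_(T \in @max_tori F K iota n.+1) (ratr (charpol_eval P (sigma F T)) :
      R) =
  evx q^-1 (hilb (@charpol_eval k P) n).
Proof.
have [r [_ _ rP]] := @fix_seq_exists F K iota (n.+1)`! (fact_gt0 _).
rewrite (sum_max_tori rP (g := fun w => ratr (charpol_eval P w))); last first.
  move=> w M /(goodP rP)[uM hM]; congr ratr.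
  by rewrite /charpol_eval; apply: meval_eq => i;
    rewrite (num_cycles_sigma _ uM hM).
rewrite evxZ evx_sum fmorphV rmorph_nat !mulr_sumr; apply: eq_bigr => w _.
by rewrite evxZ evx_chip; ring.
Qed.

Lemma coef_hilb n i : (hilb (@charpol_eval k P) n)`_i = coinv_inner P n.+1 i.
Proof.
rewrite /hilb /coinv_inner coefZ coef_sum; congr (_ * _); apply: eq_bigr => w _.
by rewrite coefZ coef_chip.
Qed.

End TorusAverage.

(** * Passage to the limit in the size of the matrices *)

Local Open Scope classical_set_scope.
Local Open Scope ring_scope.

Theorem theorem5p6 (R : realType) (F : finFieldType) (K : closedFieldType)
    (iota : {rmorphism F -> K}) (iota_alg : integralRange iota)
    (k : nat) (P : {mpoly rat[k]}) :
  let q : R := #|F|%:R in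
  let torus_avg (n : nat) : R :=
    (q ^+ (n ^ 2 - n))^-1 *
      \sum_(T \in @max_tori F K iota n) (ratr (charpol_eval P (sigma F T)) : R) in
  let term (i : nat) : R := stable_inner R P i / q ^+ i in
  [/\ cvgn torus_avg, cvgn (series term)
    & limn torus_avg = limn (series term)].
Proof.
move=> q torus_avg term.
have x0 : 0 <= q^-1 by rewrite invr_ge0 ler0n.
have x1 : q^-1 < 1 by rewrite invf_lt1 ?q_gt1 // ltr0n ltnW // card_field_gt1.
have [f [L [stab sL vL]]] := stable_charpol x0 x1 P.
have avgL : torus_avg @ \oo --> L.
  (* The shift by one matches [hilb] at index [n] with matrices of size [n.+1]. *)
  rewrite -(cvg_shiftn 1); rewrite (_ : (fun n => _) =
    fun n => evx q^-1 (hilb (@charpol_eval k P) n)) //.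
  by apply/funext => n; rewrite addn1 -(torus_avgE R iota).
have innerE i : stable_inner R P i = ratr (f i).
  apply: cvg_lim => //; apply: cvg_near_cst.
  have [N hN] := stab i; exists N.+1 => // -[//|n] /= hn.
  by rewrite -coef_hilb hN.
have serL : series term @ \oo --> L.
  rewrite (_ : term = fun i => ratr (f i) * q^-1 ^+ i) //.
  by apply/funext => i; rewrite /term innerE exprVn.
split; [exact: cvgP avgL | exact: cvgP serL |].
by rewrite (cvg_lim _ avgL) // (cvg_lim _ serL).
Qed.
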